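(* Let $\ell\ge2$ be an integer and for $x\in\mathbb{R}^{\ell-1}$, $x'\in\mathbb{R}$ let $$Tf(x,x'):=\int_{\mathbb{R}^{\ell-1}}f(x+t,\,x'+\|t\|^2)\,dt .$$ Then $T$ satisfies a restricted strong-type $L^{\ell/(\ell-1)}(\mathbb{R}^{\ell-1}\times\mathbb{R})\to L^\infty_{x'}(L^\ell_x)$ inequality: there is a finite constant $C$ depending only on $\ell$ such that for every Borel set $E\subset\mathbb{R}^{\ell-1}\times\mathbb{R}$, $$\operatorname*{ess\,sup}_{x'\in\mathbb{R}}\left(\int_{\mathbb{R}^{\ell-1}}|T\chi_E(x,x')|^{\ell}\,dx\right)^{1/\ell}\le C\,|E|^{(\ell-1)/\ell}.$$
   Context: $\chi_E$ is the characteristic function of $E$, $|E|$ is Lebesgue measure on $\mathbb{R}^{\ell-1}\times\mathbb{R}=\mathbb{R}^\ell$, and $\|t\|$ is the Euclidean norm. *)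

(* Defs.v *)
From HB Require Import structures.
From mathcomp Require Import all_boot all_order all_algebra.
From mathcomp Require Import all_classical all_reals all_analysis.

Set Implicit Arguments.
Unset Strict Implicit.
Unset Printing Implicit Defensive.

Import Order.TTheory GRing.Theory Num.Theory.
Import numFieldNormedType.Exports.

Local Open Scope classical_set_scope.
Local Open Scope ring_scope.

(* R^n, with the sigma-algebra generated by the coordinate projections. Since R
   is second countable, this is the Borel sigma-algebra of R^n, and the
   measurable sets of [euclid R n * measurableTypeR R] are the Borel sets of
   R^n * R. *)
Notation euclid R n := (n.-tuple (measurableTypeR R)).

Section lebesgue_euclid.
Context {R : realType}.

Definition tcons {n} (p : measurableTypeR R * euclid R n) : euclid R n.+1 :=
  [tuple of p.1 :: p.2].

Lemma measurable_tcons n : measurable_fun [set: _] (@tcons n).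
Proof. exact: measurable_cons. Qed.

Section step.
Local Open Scope ereal_scope.
Variables (n : nat) (m : {sigma_finite_measure set (euclid R n) -> \bar R}).

Definition leb_step : set (euclid R n.+1) -> \bar R :=
  pushforward (lebesgue_measure \x m) tcons.

Let leb_step0 : leb_step set0 = 0.
Proof. by rewrite /leb_step/pushforward preimage_set0 measure0. Qed.

Let leb_step_ge0 A : 0 <= leb_step A.
Proof. exact: (measure_ge0 (lebesgue_measure \x m)). Qed.

Let leb_step_sigma_additive : semi_sigma_additive leb_step.
Proof.
move=> F mF tF mUF; rewrite /leb_step /pushforward preimage_bigcup.
have mtcons A : measurable A -> measurable (@tcons n @^-1` A).
  by move=> mA; rewrite -[X in measurable X]setTI; exact: measurable_tcons.
apply: (@measure_semi_sigma_additive _ _ _ (lebesgue_measure \x m)).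
- by move=> k; exact: mtcons.
- apply/trivIsetP => /= i j _ _ ij; rewrite -preimage_setI.
  by move/trivIsetP : tF => /(_ _ _ _ _ ij) ->//; rewrite preimage_set0.
- by rewrite -preimage_bigcup; exact: mtcons.
Qed.

HB.instance Definition _ :=
  isMeasure.Build _ _ _ leb_step
    leb_step0 leb_step_ge0 leb_step_sigma_additive.

Let leb_step_sigma_finite : sigma_finite setT leb_step.
Proof.
have /sigma_finiteP[F [TF ndF Foo]] := sigma_finiteT (@lebesgue_measure R).
have /sigma_finiteP[G [TG ndG Goo]] := sigma_finiteT m.
pose uncons (t : euclid R n.+1) : measurableTypeR R * euclid R n :=
  (thead t, [tuple of behead t]).
have muncons : measurable_fun setT uncons.
  apply: measurable_fun_pair; first exact: measurable_tnth.
  exact: measurable_behead.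
have tconsK : cancel tcons uncons.
  by move=> [x t]; congr pair; exact/val_inj.
exists (fun k => uncons @^-1` (F k `*` G k)).
  rewrite -preimage_bigcup (_ : \bigcup_k _ = setT) ?preimage_setT//.
  rewrite -subTset => -[x t] _.
  have [i _ Fx] : (\bigcup_i F i) x by rewrite -TF.
  have [j _ Gt] : (\bigcup_j G j) t by rewrite -TG.
  exists (maxn i j) => //; split => /=.
  - by move: x Fx; exact/subsetPset/ndF/leq_maxl.
  - by move: t Gt; exact/subsetPset/ndG/leq_maxr.
move=> k; have [mF Fk] := Foo k; have [mG Gk] := Goo k; split.
  by rewrite -[X in measurable X]setTI; apply: muncons => //; exact: measurableX.
rewrite /leb_step /pushforward -comp_preimage.
rewrite (_ : uncons \o tcons = id) ?preimage_id; last exact/funext.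
by rewrite product_measure1E// lte_mul_pinfty// ge0_fin_numE.
Qed.

HB.instance Definition _ := Measure_isSigmaFinite.Build _ _ _ leb_step
  leb_step_sigma_finite.
End step.

(* Lebesgue measure on R^n, as the n-fold product of Lebesgue measure on R. *)
Fixpoint leb (n : nat) : {sigma_finite_measure set (euclid R n) -> \bar R} :=
  match n with
  | 0 => \d_([tuple] : euclid R 0)
  | n'.+1 => leb_step (leb n')
  end.

Lemma measurable_box n (A : 'I_n -> set (measurableTypeR R)) :
  (forall i, measurable (A i)) ->
  measurable [set t : euclid R n | forall i, A i (tnth t i)].
Proof.
move=> mA.
rewrite (_ : [set _ | _] =
    \bigcap_(i in [set: 'I_n]) ((fun t : euclid R n => tnth t i) @^-1` A i)).
  apply: fin_bigcap_measurable => [|i _]; first exact: finite_finset.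
  by rewrite -[X in measurable X]setTI; exact: measurable_tnth.
by apply/seteqP; split => t /= At i => [_|]; exact: At.
Qed.

Lemma leb_box n (A : 'I_n -> set (measurableTypeR R)) :
  (forall i, measurable (A i)) ->
  leb n [set t | forall i, A i (tnth t i)] =
  (\prod_(i < n) lebesgue_measure (A i))%E.
Proof.
elim: n A => [|n IH] A mA.
  by rewrite big_ord0/= diracE mem_set// => -[].
rewrite big_ord_recl -IH//=.
rewrite /leb_step /pushforward -product_measure1E//; last first.
  exact: (measurable_box (fun i => mA (lift ord0 i))).
congr (_ _); apply/seteqP; split => -[x t]/=.
  move=> At; split; first exact: (At ord0).
  by move=> i; have := At (lift ord0 i); rewrite tnthS.
move=> [Ax At] i; case: (unliftP ord0 i) => [j ->|->]; last exact: Ax.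
by rewrite tnthS; exact: At.
Qed.

End lebesgue_euclid.

Section paraboloid.
Context {R : realType} {n : nat}.
Implicit Types x t : euclid R n.

Definition eadd x t : euclid R n :=
  [tuple (tnth x i + tnth t i : R) | i < n].

Definition enorm t : R := Num.sqrt (\sum_(i < n) (tnth t i : R) ^+ 2).

(* The integral is [\bar R]-valued: for nonnegative measurable [f] it always
   makes sense, possibly with the value [+oo]. *)
Definition paraT (f : euclid R n * measurableTypeR R -> R) x
    (x' : measurableTypeR R) : \bar R :=
  (\int[leb n]_t (f (eadd x t, (x' : R) + enorm t ^+ 2))%:E)%E.

End paraboloid.

(* Main.v *)
Require Import Defs.
From mathcomp Require Import all_boot all_order all_algebra.
From mathcomp Require Import all_classical all_reals all_analysis ess_sup_inf.
From mathcomp Require Import measurable_realfun.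
From mathcomp Require Import ring lra.

(** Write d = ell - 1 and fix x'. Substituting y = x + t,
    F(x) := T 1_E(x, x') is the measure of the set A_x of those y in R^d for
    which (y, x' + |y - x|^2) lies in E. For d points y_1, ..., y_d let
    det(y_i - x) be the determinant of the matrix with rows y_i - x, that is,
    d! times the signed volume of the simplex with vertices x, y_1, ..., y_d.
    The bound follows from two inequalities about this determinant.

    - A set of large measure spans large simplices: with c > 0 depending on d
      only, c |A|^(d+1) is at most the integral of |det(y_i - x)| over all
      (y_1, ..., y_d) in A^d ([simplex_lower_bound]).
    - For fixed y_1, ..., y_d the Jacobian of the map
      x |-> (|y_1 - x|^2, ..., |y_d - x|^2) is, up to sign, 2^d det(y_i - x),
      and d spheres with affinely independent centres meet in at most two
      points. Hence the integral over x of
      |det(y_i - x)| h_1(x' + |y_1 - x|^2) ... h_d(x' + |y_d - x|^2) is at most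
      the product of the integrals of the h_i ([integral_spheres_le]).

    The first inequality, with A = A_x, bounds c times the integral of F^(d+1)
    by the integral over x and over (y_1, ..., y_d) in A_x^d of |det(y_i - x)|.
    Integrating over x first and using the second inequality with
    h_i(u) = 1_E(y_i, u) bounds this by the product over i of the integrals of
    |E_(y_i)|, where E_y is the fibre of E above y; that product is |E|^d
    ([integral_wint_le]). Thus the integral of F^ell is at most
    c^-1 |E|^(ell-1), for every x' and not merely almost every one.

    The first inequality is proved for a function 0 <= f <= lam in place of the
    indicator of A, by induction on d. Let F(z) be the integral of f(s, z) in
    the first coordinate s. The determinant is affine in the first coordinate
    of y_1, with slope the determinant of the other points projected to
    R^(d-1), and a function bounded by lam with integral F(z) cannot
    concentrate near the zero of an affine function. So the d-dimensional
    integral is bounded below by the integral of F^2 times the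
    (d-1)-dimensional integral for F. The latter is bounded below by truncating
    F at a multiple of the ratio of the integrals of F^2 and F.

    In the second inequality, let v be normal to the hyperplane through the
    y_i. In the linear coordinates s = v . (x - y_1) and
    w_i = (y_i - y_1) . (x - y_1) the determinant is s up to sign, |x - y_1|^2
    is s^2 / |v|^2 plus a function of w, and
    |x - y_i|^2 = |x - y_1|^2 - 2 w_i + const. Only a linear change of variables
    ([integral_affine_le]) and the one-dimensional substitution u = s^2
    ([ge0_integral_sqr_le]) are needed. *)

Set Implicit Arguments.
Unset Strict Implicit.
Unset Printing Implicit Defensive.

Import Order.TTheory GRing.Theory Num.Theory.
Import numFieldNormedType.Exports.

Local Open Scope classical_set_scope.
Local Open Scope ring_scope.

(** * Tonelli for curried functions *)

Section curried_tonelli.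
Local Open Scope ereal_scope.
Context d1 d2 (T1 : measurableType d1) (T2 : measurableType d2) (R : realType).
Variables (m1 : {sigma_finite_measure set T1 -> \bar R}).
Variables (m2 : {sigma_finite_measure set T2 -> \bar R}).
Variable G : T1 -> T2 -> \bar R.
Hypothesis mG : measurable_fun [set: T1 * T2] (fun p => G p.1 p.2).
Hypothesis G0 : forall x y, 0 <= G x y.

Lemma measurable_intr : measurable_fun [set: T1] (fun x => \int[m2]_y G x y).
Proof.
exact: (@measurable_fun_fubini_tonelli_F _ _ _ _ _ m2
  (fun p => G p.1 p.2) mG (fun p => G0 p.1 p.2)).
Qed.

Lemma measurable_intl : measurable_fun [set: T2] (fun y => \int[m1]_x G x y).
Proof.
exact: (@measurable_fun_fubini_tonelli_G _ _ _ _ _ m1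
  (fun p => G p.1 p.2) mG (fun p => G0 p.1 p.2)).
Qed.

Lemma tonelli_swap :
  \int[m1]_x \int[m2]_y G x y = \int[m2]_y \int[m1]_x G x y.
Proof. by apply: (fubini_tonelli _ mG) => -[x y]; exact: G0. Qed.

End curried_tonelli.

(** * Substitutions on the real line *)

Section line.
Context {R : realType}.
Local Notation mu := (@lebesgue_measure R).
Local Notation TR := (measurableTypeR R).
Local Open Scope ereal_scope.

Lemma ge0_integral_mrestr d (T : measurableType d)
    (m : {measure set T -> \bar R}) (D : set T) (mD : measurable D)
    (f : T -> \bar R) :
  measurable_fun [set: T] f -> (forall x, 0 <= f x) ->
  \int[mrestr m mD]_x f x = \int[m]_(x in D) f x.
Proof.
move=> mf f0; rewrite -(setUv D) ge0_integral_setU//=; last 3 first.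
- exact: measurableC.
- exact: measurable_funS mf.
- exact/disj_setPCl.
rewrite [X in _ + X](_ : _ = 0) ?adde0.
  apply: eq_measure_integral => A mA AD.
  by rewrite /= /mrestr setIidl.
rewrite -(integral_measure_zero (~` D) f).
apply: eq_measure_integral => A mA AD /=; rewrite /mrestr.
by move/disjoints_subset: AD => ->; rewrite measure0.
Qed.

Section weighted.
Variables (phi : TR -> TR) (w : TR -> R).
Hypothesis mphi : measurable_fun [set: _] phi.
Hypothesis mw : measurable_fun [set: _] w.
Hypothesis w0 : forall s, (0 <= w s)%R.

(* The measure with density w is the first marginal of the area below the
   graph of w. *)
Let subgraph : set (TR * TR) := [set z | (0 < (z.2 : R))%R && ((z.2 : R) <= w z.1)%R].

Let msubgraph : measurable subgraph.
Proof.
rewrite -[X in measurable X]setTI.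
apply: (measurable_and (f := fun z : TR * TR => (0 < (z.2 : R))%R)
  (g := fun z => ((z.2 : R) <= w z.1)%R)) => //.
  exact: measurable_fun_ltr.
by apply: measurable_fun_ler => //; exact: measurableT_comp.
Qed.

Let mphi1 : measurable_fun [set: _] (phi \o fst : TR * TR -> TR).
Proof. exact: measurableT_comp. Qed.

Let weighted_pushforward :
  exists nu : {measure set TR -> \bar R}, forall h : TR -> \bar R,
    measurable_fun [set: _] h -> (forall u, 0 <= h u) ->
    \int[nu]_u h u = \int[mu]_s ((w s)%:E * h (phi s)).
Proof.
unshelve eexists (pushforward (mrestr (mu \x mu) msubgraph) (phi \o fst)).
  exact: mphi1.
move=> h mh h0; rewrite ge0_integral_pushforward//=.
have mhphi : measurable_fun [set: _] (fun z : TR * TR => h (phi z.1)).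
  apply: measurableT_comp => //.
rewrite ge0_integral_mrestr//.
rewrite integral_mkcond fubini_tonelli1//; last 2 first.
- exact/(measurable_restrictT _ _).1/measurable_funTS.
- by move=> x; exact: erestrict_ge0.
apply: eq_integral => s _; rewrite /fubini_F/=.
rewrite -[RHS]muleC.
transitivity (\int[mu]_(r in `]0%R, (w s)]) h (phi s)).
  rewrite [RHS]integral_mkcond; apply: eq_integral => r _.
  by rewrite !patchE /= !mem_setE /subgraph/= in_itv.
rewrite integral_cst//= lebesgue_measure_itv/= lte_fin.
case: ltP => [_|]; first by rewrite sube0.
by move=> ws0; rewrite (@le_anti _ _ (w s) 0%R) ?w0// ws0.
Qed.

(** Lebesgue measure is determined by half-open intervals, so the substitution
    u = phi s holds for every measurable h >= 0 once the weight w has the right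
    integral over the preimages of intervals. *)
Lemma ge0_integral_weighted_comp :
  (forall a b : R, (a < b)%R ->
     \int[mu]_(s in phi @^-1` `]a, b]) (w s)%:E = (b - a)%:E) ->
  forall h : TR -> \bar R, measurable_fun [set: _] h -> (forall u, 0 <= h u) ->
  \int[mu]_s ((w s)%:E * h (phi s)) = \int[mu]_u h u.
Proof.
move=> wab h mh h0; have [nu integral_nu] := weighted_pushforward.
rewrite -integral_nu//.
apply: eq_measure_integral => A mA _.
apply/esym/lebesgue_measure_unique => //= _ [[a b]] _ <-.
rewrite lebesgue_measure_itv/= lte_fin -EFinB.
have [ab|ba] := ltP a b; last first.
  by rewrite set_itv_ge ?measure0// bnd_simp -leNgt.
rewrite -wab//.
rewrite -[X in _ = nu X]setIT -(integral_indic nu)// integral_nu//.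
  rewrite integral_mkcond; apply: eq_integral => s _.
  rewrite patchE indicE.
  rewrite (_ : (s \in phi @^-1` `]a, b]) = (phi s \in `]a, b]%classic))//.
  by case: ifPn => _; rewrite ?mule1 ?mule0.
exact/measurable_EFinP.
Qed.
End weighted.

Lemma ge0_integral_affine (c b : R) (h : TR -> \bar R) : c != 0%R ->
  measurable_fun [set: _] h -> (forall u, 0 <= h u) ->
  `|c|%:E * \int[mu]_s h (c * s + b)%R = \int[mu]_u h u.
Proof.
move=> c0 mh h0.
have mphi : measurable_fun [set: TR] (fun s : TR => (c * s + b)%R : TR).
  by apply: measurable_funD => //; exact: measurable_funM.
rewrite -[RHS](@ge0_integral_weighted_comp (fun s => (c * s + b)%R) (fun=> `|c|%R))//.
  by rewrite ge0_integralZl// ?lee_fin//; exact: (measurableT_comp mh mphi).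
move=> x y xy; have mxy : measurable ((fun s : TR => (c * s + b)%R) @^-1` `]x, y]).
  by rewrite -[X in measurable X]setTI; exact: mphi.
rewrite integral_cst//.
have [cp|cn|] := ltgtP c 0%R; last by move=> c00; rewrite c00 eqxx in c0.
  rewrite (_ : _ @^-1` _ = `[((y - b) / c)%R, ((x - b) / c)%R[%classic); last first.
    apply/seteqP; split => s /=; rewrite !in_itv/= ?ler_ndivrMr ?ltr_ndivlMr//.
      by move=> /andP[? ?]; apply/andP; split; lra.
    by move=> /andP[? ?]; apply/andP; split; lra.
  rewrite [X in _ * X]lebesgue_measure_itv/= lte_fin ltr_nM2r ?invr_lt0// ltrD2r xy.
  by rewrite -EFinB -EFinM ltr0_norm//; congr EFin; field.
rewrite (_ : _ @^-1` _ = `]((x - b) / c)%R, ((y - b) / c)%R]%classic); last first.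
  apply/seteqP; split => s /=; rewrite !in_itv/= ?ler_pdivlMr ?ltr_pdivrMr//.
    by move=> /andP[? ?]; apply/andP; split; lra.
  by move=> /andP[? ?]; apply/andP; split; lra.
rewrite [X in _ * X]lebesgue_measure_itv/= lte_fin ltr_pM2r ?invr_gt0// ltrD2r xy.
by rewrite -EFinB -EFinM gtr0_norm//; congr EFin; field.
Qed.

(** An increasing bijection of the line with derivative 2|s|: it makes u = s^2 a
    substitution on the whole line at once. *)
Definition ssqr (s : R) : R := s * `|s|.

Lemma is_derive_ssqr (s : R) : is_derive s 1%R ssqr (2 * `|s|)%R.
Proof.
have [s0|s0|->] := ltgtP s 0%R.
- have e : {near s, (fun u => - (u * u))%R =1 ssqr}.
    near=> u; rewrite /ssqr ltr0_norm ?mulrN//; near: u; exact: lt_nbhsl.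
  apply: (near_eq_is_derive e).
  by apply: is_derive_eq; rewrite ltr0_norm// !scaler1; ring.
- have e : {near s, (fun u => u * u)%R =1 ssqr}.
    near=> u; rewrite /ssqr gtr0_norm//; near: u; exact: lt_nbhsr.
  apply: (near_eq_is_derive e).
  by apply: is_derive_eq; rewrite gtr0_norm// !scaler1; ring.
(* At 0 the difference quotient of s |-> s |s| is |h|. *)
have c0 : (fun h : R => `|h|%R) @ 0%R^' --> (0 : R)%R.
  apply: cvg_within_filter.
  by have := @norm_continuous R R 0%R; rewrite /continuous_at normr0.
have e : (fun h : R => (h^-1 *: (ssqr (h *: 1 + 0) - ssqr 0))%R) @ 0%R^' --> (0 : R)%R.
  apply: cvg_trans c0.
  apply: near_eq_cvg; near=> h.
  have h0 : h != 0%R by near: h; exact: nbhs_dnbhs_neq.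
  rewrite /ssqr scaler1 addr0 mul0r subr0 /GRing.scale/= mulrA mulVf ?mul1r//.
rewrite normr0 mulr0.
split; first by apply/cvg_ex; exists 0%R.
exact/cvg_lim.
Unshelve. all: by end_near. Qed.

Lemma measurable_ssqr : measurable_fun [set: TR] (ssqr : TR -> TR).
Proof. by apply: measurable_funM => //; exact: measurableT_comp. Qed.

Lemma ssqr_mono : {mono ssqr : x y / (x <= y)%R}.
Proof.
apply: le_mono => x y xy; rewrite /ssqr.
have [x0|x0] := ltP x 0%R; have [y0|y0] := ltP y 0%R.
- by rewrite !ltr0_norm//; nra.
- by rewrite ltr0_norm// ger0_norm//; nra.
- by rewrite ger0_norm// ltr0_norm//; nra.
- by rewrite !ger0_norm//; nra.
Qed.

Lemma ssqr_surj (a : R) : exists x, ssqr x = a.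
Proof.
rewrite /ssqr; have [a0|a0] := leP 0%R a.
  exists (Num.sqrt a); rewrite ger0_norm ?sqrtr_ge0//.
  by rewrite -expr2 sqr_sqrtr.
exists (- Num.sqrt (- a))%R; rewrite normrN ger0_norm ?sqrtr_ge0//.
by rewrite mulNr -expr2 sqr_sqrtr ?opprK// oppr_ge0 ltW.
Qed.

Lemma integral_ssqr (h : TR -> \bar R) :
  measurable_fun [set: _] h -> (forall u, 0 <= h u) ->
  \int[mu]_s ((2 * `|s|)%:E * h (ssqr s)) = \int[mu]_u h u.
Proof.
move=> mh h0.
have mnorm : measurable_fun [set: TR] (fun s : TR => (2 * `|s|)%R).
  by apply: measurable_funM => //; exact: measurableT_comp.
apply: (@ge0_integral_weighted_comp ssqr (fun s => (2 * `|s|)%R)) => //.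
  exact: measurable_ssqr.
move=> a b; have [x <-] := ssqr_surj a; have [y <-] := ssqr_surj b.
rewrite (leW_mono ssqr_mono) => xy.
rewrite (_ : _ @^-1` _ = ([set` `]x, y]] : set R)); last first.
  by apply/seteqP; split => s /=; rewrite !in_itv/= ssqr_mono (leW_mono ssqr_mono).
rewrite integral_itv_obnd_cbnd; last first.
  by apply/measurable_EFinP; exact: measurable_funS mnorm.
have cs s : {for s, continuous ssqr}.
  by apply/differentiable_continuous/derivable1_diffP; have [] := is_derive_ssqr s.
rewrite (@continuous_FTC2 _ _ ssqr)//.
- apply: continuous_subspaceT => s; apply: cvgM; first exact: cvg_cst.
  exact: norm_continuous.
- split.
  + by move=> s _; have [] := is_derive_ssqr s.
  + by apply: cvg_at_right_filter; exact: cs.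
  + by apply: cvg_at_left_filter; exact: cs.
- by move=> s _; rewrite derive1E; have [_ ->] := is_derive_ssqr s.
Qed.

(** Up to the affine change of scale this is the substitution u = s^2: twice the
    left-hand side is the integral of h(|u| / q + b), and h(|u| / q + b) is at
    most h(u / q + b) + h(- u / q + b). *)
Lemma ge0_integral_sqr_le (q b : R) (h : TR -> \bar R) : (0 < q)%R ->
  measurable_fun [set: _] h -> (forall u, 0 <= h u) ->
  \int[mu]_s (`|s|%:E * h (s ^+ 2 / q + b)%R) <= q%:E * \int[mu]_u h u.
Proof.
move=> q0 mh h0.
have mnorm : measurable_fun [set: TR] (fun s : TR => `|s|%R).
  exact: measurableT_comp.
have mc (c : R) : measurable_fun [set: TR] (fun s : TR => h (c * s + b)%R).
  apply: (measurableT_comp mh).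
  by apply: measurable_funD => //; exact: measurable_funM.
have mqn : measurable_fun [set: TR] (fun s : TR => h (`|s| / q + b)%R).
  apply: (measurableT_comp mh).
  apply: measurable_funD => //; apply: measurable_funM => //.
have E : 2%:E * \int[mu]_s (`|s|%:E * h (s ^+ 2 / q + b)%R)
    <= 2%:E * (q%:E * \int[mu]_u h u).
  have -> : 2%:E * \int[mu]_s (`|s|%:E * h (s ^+ 2 / q + b)%R)
     = \int[mu]_u h (`|u| / q + b)%R.
    rewrite -[RHS]integral_ssqr// -ge0_integralZl//; last 2 first.
    - apply: emeasurable_funM; first exact/measurable_EFinP.
      apply: (measurableT_comp mh).
      apply: measurable_funD => //; apply: measurable_funM => //.
    - by move=> s _; rewrite mule_ge0// lee_fin.
    apply: eq_integral => s _; rewrite muleA -EFinM; congr (_ * h _)%E.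
    by rewrite /ssqr normrM normr_id -normrM -expr2 ger0_norm ?sqr_ge0.
  apply: (@le_trans _ _ (\int[mu]_u (h (q^-1 * u + b)%R + h (- q^-1 * u + b)%R))).
    apply: ge0_le_integral => //.
      by apply: emeasurable_funD; exact: mc.
    move=> u _; have [u0|u0] := leP 0%R u.
      by rewrite ger0_norm// mulrC leeDl.
    by rewrite ltr0_norm// mulrC mulrN -mulNr leeDr.
  rewrite ge0_integralD//.
  have H c : c != 0%R -> \int[mu]_s h (c * s + b)%R = `|c^-1|%:E * \int[mu]_u h u.
    move=> c0; rewrite -(ge0_integral_affine b c0 mh h0) muleA -EFinM -normrM mulVf//.
    by rewrite normr1 mul1e.
  rewrite !H ?oppr_eq0 ?invr_eq0 ?gt_eqF//.
  rewrite -invrN !invrK normrN gtr0_norm//.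
  by rewrite mule_natl mule2n lexx.
by rewrite lee_pmul2l in E.
Qed.

End line.

(** * Integrals over R^n *)

Section euclid_integral.
Context {R : realType}.
Local Notation mu := (@lebesgue_measure R).
Local Notation TR := (measurableTypeR R).

(** Points of R^n are tuples, for the sake of the product sigma-algebra; the
    linear algebra is done on column vectors. *)
Definition vec n (x : euclid R n) : 'cV[R]_n := \col_i (tnth x i : R).
Definition tup n (v : 'cV[R]_n) : euclid R n := [tuple v i ord0 | i < n].

Lemma tupK n : cancel (@tup n) (@vec n).
Proof. by move=> v; apply/matrixP => i j; rewrite mxE tnth_mktuple (ord1 j). Qed.

Lemma vecK n : cancel (@vec n) (@tup n).
Proof. by move=> x; apply/eq_from_tnth => i; rewrite tnth_mktuple mxE. Qed.

Lemma vec_tcons n (s : TR) (z : euclid R n) :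
  vec (tcons (s, z)) = col_mx (s : R)%:M (vec z) :> 'cV_(1 + n).
Proof.
apply/matrixP => i j; rewrite !mxE (ord1 j).
case: splitP => k ik.
  rewrite (ord1 k) !mxE/= (_ : i = ord0)//; apply/val_inj; by rewrite /= ik (ord1 k).
rewrite mxE (_ : i = lift ord0 k) ?tnthS//.
exact/val_inj.
Qed.

Lemma tup_col_mx n (a : 'cV[R]_1) (v : 'cV[R]_n) :
  tup (col_mx a v : 'cV_n.+1) = tcons (a ord0 ord0 : TR, tup v).
Proof.
apply: (can_inj (@vecK _)); rewrite tupK vec_tcons tupK.
rewrite (_ : (a ord0 ord0)%:M = a)//.
by apply/matrixP => i j; rewrite !ord1 mxE.
Qed.

Lemma measurable_tup d (T : measurableType d) n (v : T -> 'cV[R]_n) :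
  (forall i, measurable_fun [set: T] (fun x => v x i ord0)) ->
  measurable_fun [set: T] (fun x => tup (v x)).
Proof.
move=> mv; apply/measurable_fun_tnthP => i.
rewrite (_ : _ \o _ = fun x => v x i ord0); first exact: mv.
by apply/funext => x /=; rewrite tnth_mktuple.
Qed.

Lemma measurable_vec n i :
  measurable_fun [set: euclid R n] (fun x => vec x i ord0).
Proof.
rewrite (_ : (fun _ => _) = (fun x : euclid R n => tnth x i : R)).
  exact: measurable_tnth.
by apply/funext => x; rewrite mxE.
Qed.

Lemma measurable_mulmx d (T : measurableType d) m n p (A : T -> 'M[R]_(m, n))
    (B : T -> 'M[R]_(n, p)) i j :
  (forall k, measurable_fun [set: T] (fun x => A x i k)) ->
  (forall k, measurable_fun [set: T] (fun x => B x k j)) ->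
  measurable_fun [set: T] (fun x => (A x *m B x) i j).
Proof.
move=> mA mB; under eq_fun do rewrite mxE.
by apply: measurable_sum => k; apply: measurable_funM.
Qed.

Local Open Scope ereal_scope.

Lemma integral_leb0 (f : euclid R 0 -> \bar R) :
  \int[leb 0]_x f x = f [tuple].
Proof.
rewrite /= integral_dirac//.
  by rewrite diracT mul1e.
move=> _ Y mY.
have [/asboolP h|/asboolP h] := boolP `[< Y (f [tuple]) >].
  rewrite (_ : f @^-1` Y = setT) ?setTI//.
  by apply/seteqP; split => // x _; rewrite /= (tuple0 x).
rewrite (_ : f @^-1` Y = set0) ?setI0//.
by apply/seteqP; split => // x /=; rewrite (tuple0 x).
Qed.

Section step.
Variables (n : nat) (f : euclid R n.+1 -> \bar R).
Hypotheses (mf : measurable_fun [set: _] f) (f0 : forall x, 0 <= f x).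

Lemma measurable_slice :
  measurable_fun [set: _] (fun p => f (tcons (p.1, p.2))).
Proof.
rewrite (_ : (fun _ => _) = f \o tcons); last by apply/funext => -[].
exact: (measurableT_comp mf (@measurable_tcons _ _)).
Qed.

Lemma integral_lebS :
  \int[leb n.+1]_x f x = \int[mu]_s \int[leb n]_z f (tcons (s, z)).
Proof.
transitivity (\int[mu \x leb n]_p (f \o tcons) p).
  rewrite -(preimage_setT (@tcons R n)) -ge0_integral_pushforward//.
    exact: measurable_tcons.
rewrite fubini_tonelli1//; last by move=> x; exact: f0.
exact: (measurableT_comp mf (@measurable_tcons _ _)).
Qed.

Lemma integral_lebS_swap :
  \int[leb n.+1]_x f x = \int[leb n]_z \int[mu]_s f (tcons (s, z)).
Proof. by rewrite integral_lebS (tonelli_swap _ _ measurable_slice). Qed.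

Lemma measurable_int_slice :
  measurable_fun [set: _] (fun z => \int[mu]_s f (tcons (s, z))).
Proof. exact: (measurable_intl _ measurable_slice). Qed.

End step.
End euclid_integral.

(** * Linear changes of variables *)

Section linear.
Context {R : realType}.
Local Notation mu := (@lebesgue_measure R).
Local Notation TR := (measurableTypeR R).
Local Open Scope ereal_scope.

Definition affine n (M : 'M[R]_n) (b : 'cV[R]_n) (x : euclid R n) : euclid R n :=
  tup (M *m vec x + b)%R.

Lemma measurable_affine_param d (T : measurableType d) n (M : 'M[R]_n)
    (b : T -> 'cV[R]_n) (x : T -> euclid R n) :
  (forall i, measurable_fun [set: T] (fun t => b t i ord0)) ->
  measurable_fun [set: T] x ->
  measurable_fun [set: T] (fun t => affine M (b t) (x t)).
Proof.
move=> mb mx; apply: measurable_tup => i.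
under eq_fun do rewrite mxE.
apply: measurable_funD => //; apply: measurable_mulmx => k //.
exact: (measurableT_comp (@measurable_vec _ _ k) mx).
Qed.

Lemma measurable_affine n (M : 'M[R]_n) b : measurable_fun [set: _] (affine M b).
Proof. exact: measurable_affine_param. Qed.

(** One step of Gaussian elimination. The substitution
    u = c s + r . z + b0 in the first coordinate s, for fixed z, turns the other
    coordinates of the affine map into S z + const(u), where S is the Schur
    complement of the nonzero pivot c; what remains is the map S, for fixed u. *)
Lemma integral_affine_pivot_le n (c b0 : R) (r : 'rV[R]_n) (c' : 'cV[R]_n) (S : 'M[R]_n)
    (b' : 'cV[R]_n) (f : euclid R n.+1 -> \bar R) :
  (forall b (g : euclid R n -> \bar R), measurable_fun [set: _] g ->
    (forall x, 0 <= g x) ->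
    `|\det S|%:E * \int[leb n]_x g (affine S b x) <= \int[leb n]_x g x) ->
  measurable_fun [set: _] f -> (forall x, 0 <= f x) -> c != 0%R ->
  `|c * \det S|%:E * \int[leb n.+1]_x
     f (affine (block_mx c%:M r c' (S + c^-1 *: (c' *m r))%R : 'M[R]_n.+1)
        (col_mx b0%:M b' : 'cV[R]_n.+1) x) <= \int[leb n.+1]_x f x.
Proof.
move=> IH mf f0 c0.
rewrite integral_lebS_swap//; last first.
  exact: (measurableT_comp mf (measurable_affine _ _)).
pose B (u : R) : 'cV[R]_n := (c^-1 * (u - b0) *: c' + b')%R.
have E s z : affine (block_mx c%:M r c' (S + c^-1 *: (c' *m r))%R : 'M[R]_n.+1)
    (col_mx b0%:M b' : 'cV[R]_n.+1) (tcons (s, z))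
    = (fun u : R => tcons (u : TR, affine S (B u) z))
        (c * s + ((r *m vec z) ord0 ord0 + b0))%R.
  rewrite /affine vec_tcons (@mul_block_col _ 1 n 1 n 1) (@add_col_mx _ 1 n 1).
  rewrite tup_col_mx; congr (tcons (_, tup _)).
    by rewrite -scalar_mxM !mxE eqxx mulr1n addrA.
  have -> : (c' *m (s : R)%:M = s *: c')%R by rewrite mul_mx_scalar.
  rewrite mulmxDl -scalemxAl.
  have -> : (c' *m r *m vec z = (r *m vec z) ord0 ord0 *: c')%R.
    by rewrite -mulmxA [X in (c' *m X)%R]mx11_scalar mul_mx_scalar.
  move: (S *m vec z)%R ((r *m vec z) ord0 ord0) => w k.
  by apply/matrixP => i j; rewrite /B !mxE; field.
have mB : forall i, measurable_fun [set: TR * euclid R n]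
    (fun p : TR * euclid R n => B p.1 i ord0).
  move=> i; rewrite /B; under eq_fun do rewrite !mxE.
  apply: measurable_funD => //; apply: measurable_funM => //.
  by apply: measurable_funM => //; exact: measurable_funB.
have mg : measurable_fun [set: _]
    (fun p : TR * euclid R n => f (tcons (p.1, affine S (B p.1) p.2))).
  apply: (measurableT_comp mf).
  apply: (measurableT_comp (@measurable_tcons _ _)).
  by apply: measurable_fun_pair => //; exact: measurable_affine_param.
have mgz z : measurable_fun [set: TR] (fun u : TR => f (tcons (u, affine S (B u) z))).
  exact: (measurableT_comp mg (measurable_pair2 z)).
rewrite (_ : \int[leb n]_z _ = `|c|^-1%:E * \int[mu]_u \int[leb n]_z
   f (tcons (u : TR, affine S (B u) z))); last first.
  rewrite (tonelli_swap _ _ mg)//.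
  rewrite -ge0_integralZl//; last 2 first.
  - exact: (measurable_intl _ mg (fun _ _ => f0 _)).
  - by move=> z _; exact: integral_ge0.
  apply: eq_integral => z _.
  under eq_integral do rewrite E.
  rewrite -(@ge0_integral_affine _ c ((r *m vec z) ord0 ord0 + b0)%R _ c0 (mgz z))//.
  by rewrite muleA -EFinM mulVf ?normr_eq0// mul1e.
rewrite muleA -EFinM normrM mulrAC divff ?normr_eq0// mul1r.
rewrite -ge0_integralZl//; last 2 first.
- exact: (measurable_intr _ mg (fun _ _ => f0 _)).
- by move=> z _; exact: integral_ge0.
rewrite integral_lebS//; apply: ge0_le_integral => //.
- by move=> u _; rewrite mule_ge0 ?lee_fin//; exact: integral_ge0.
- apply: emeasurable_funM => //.
  exact: (measurable_intr _ mg (fun _ _ => f0 _)).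
- exact: (measurable_intr _ (measurable_slice mf) (fun _ _ => f0 _)).
move=> u _; apply: IH => //.
exact: (measurableT_comp (measurable_slice mf) (measurable_pair1 u)).
Qed.

Lemma affine_comp n (M N : 'M[R]_n) b c x :
  affine M b (affine N c x) = affine (M *m N) (M *m c + b) x.
Proof. by rewrite /affine tupK mulmxDr mulmxA addrA. Qed.

(** The change of variables formula, as an inequality so that singular M need
    no separate statement. If the pivot M_00 vanishes but the first column does
    not, a transvection adding another row to the first one makes the pivot
    nonzero; transvections have pivot 1, so they do not increase integrals. *)
Lemma integral_affine_le n (M : 'M[R]_n) b (f : euclid R n -> \bar R) :
  measurable_fun [set: _] f -> (forall x, 0 <= f x) ->
  `|\det M|%:E * \int[leb n]_x f (affine M b x) <= \int[leb n]_x f x.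
Proof.
elim: n M b f => [|n IH] M b f mf f0.
  rewrite !integral_leb0 det_mx00 normr1 mul1e.
  by rewrite (tuple0 (affine _ _ _)).
have pivot (N : 'M[R]_(1 + n)) (d : 'cV[R]_(1 + n)) (g : euclid R n.+1 -> \bar R) :
    N ord0 ord0 != 0%R -> measurable_fun [set: _] g -> (forall x, 0 <= g x) ->
    `|\det N|%:E * \int[leb n.+1]_x g (affine (N : 'M[R]_n.+1) d x)
      <= \int[leb n.+1]_x g x.
  move=> c0 mg g0.
  set c := N ord0 ord0 in c0.
  pose S := (drsubmx N - c^-1 *: (dlsubmx N *m ursubmx N))%R.
  have ulE : ulsubmx N = c%:M.
    apply/matrixP => i j; rewrite !mxE !ord1 eqxx mulr1n /c.
    by congr (N _ _); exact/val_inj.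
  have NE : N = block_mx c%:M (ursubmx N) (dlsubmx N)
                 (S + c^-1 *: (dlsubmx N *m ursubmx N))%R.
    by rewrite subrK -ulE submxK.
  have dE : d = col_mx (d ord0 ord0)%:M (dsubmx d).
    rewrite -[LHS]vsubmxK; congr col_mx.
    apply/matrixP => i j; rewrite !mxE !ord1 eqxx mulr1n.
    by congr (d _ _); exact/val_inj.
  have -> : \det N = (c * \det S)%R.
    rewrite [in LHS]NE.
    rewrite (_ : block_mx _ _ _ _ = block_mx 1%:M 0 (c^-1 *: dlsubmx N) 1%:M
      *m block_mx c%:M (ursubmx N) 0 S)%R.
      by rewrite det_mulmx det_lblock det_ublock !det1 det_scalar1 !mul1r.
    rewrite mulmx_block !mul1mx !mul0mx ?mulmx0 !addr0 mul_mx_scalar.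
    by rewrite scalerA divff// scale1r -scalemxAl addrC.
  rewrite [X in affine X](NE) [X in affine _ X]dE.
  apply: (@integral_affine_pivot_le n c (d ord0 ord0) (ursubmx N) (dlsubmx N) S
    (dsubmx d) g) => // b1 h mh h0.
  exact: IH.
have [M00|] := eqVneq (M ord0 ord0) 0%R; last by move=> /pivot; exact.
have [[i Mi0]|Mi0] := pselect (exists i : 'I_n, M (lift ord0 i) ord0 != 0%R); last first.
  suff -> : \det M = 0%R by rewrite normr0 mul0e integral_ge0.
  rewrite (expand_det_col _ ord0) big1// => k _.
  case: (unliftP ord0 k) => [i ->|->]; last by rewrite M00 mul0r.
  have [->|Mi] := eqVneq (M (lift ord0 i) ord0) 0%R; first by rewrite mul0r.
  by case: Mi0; exists i.
(* T e adds e times the row of index i + 1 to the first row. *)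
pose T (e : R) : 'M[R]_(1 + n) := block_mx 1%:M (e *: delta_mx 0 i)%R 0%R 1%:M.
have detT e : \det (T e) = 1%R by rewrite det_ublock !det1 mul1r.
have TK : T (-1)%R *m T 1%R = 1%:M.
  rewrite /T mulmx_block !mul1mx !mulmx1 !mul0mx ?mulmx0 !addr0 !add0r.
  by rewrite scale1r scaleN1r subrr -scalar_mx_block.
have mfT : measurable_fun [set: _] (f \o affine (T (-1)%R : 'M[R]_n.+1) 0%R).
  exact: (measurableT_comp mf (measurable_affine _ _)).
apply: le_trans (_ : \int[leb n.+1]_x (f \o affine (T (-1)%R : 'M[R]_n.+1) 0%R) x <= _).
  have -> : `|\det M|%R = `|\det (T 1%R *m (M : 'M[R]_(1 + n)))|%R.
    by rewrite det_mulmx detT mul1r.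
  have -> : (fun x => f (affine M b x)) = (fun x => (f \o affine (T (-1)%R : 'M[R]_n.+1) 0%R)
       (affine (T 1%R *m (M : 'M[R]_(1 + n)) : 'M[R]_n.+1)
         (T 1%R *m (b : 'cV[R]_(1 + n)))%R x)).
    apply/funext => x /=; rewrite affine_comp; congr (f (affine _ _ _)).
      by rewrite mulmxA TK mul1mx.
    by rewrite mulmxA TK mul1mx addr0.
  apply: (pivot _ _ (f \o affine (T (-1)%R : 'M[R]_n.+1) 0%R) _ mfT (fun=> f0 _)).
  rewrite -(submxK (M : 'M[R]_(1 + n))) mulmx_block.
  have -> : ord0 = lshift n ord0 :> 'I_(1 + n) by exact/val_inj.
  rewrite block_mxEul mul1mx scale1r -rowE !mxE.
  rewrite (_ : lshift n ord0 = ord0); last exact/val_inj.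
  rewrite [X in (X + _)%R](_ : _ = 0%R) ?add0r; last exact: M00.
  by rewrite (_ : rshift 1 i = lift ord0 i)//; exact/val_inj.
have := pivot (T (-1)%R) 0%R f _ mf f0; rewrite detT normr1 mul1e; apply.
have -> : ord0 = lshift n ord0 :> 'I_(1 + n) by exact/val_inj.
by rewrite block_mxEul mxE oner_eq0.
Qed.

Lemma integral_translate n (b : 'cV[R]_n) (f : euclid R n -> \bar R) :
  measurable_fun [set: _] f -> (forall x, 0 <= f x) ->
  \int[leb n]_x f (affine 1%:M b x) = \int[leb n]_x f x.
Proof.
move=> mf f0; apply/le_anti/andP; split.
  by have := integral_affine_le 1%:M b mf f0; rewrite det1 normr1 mul1e.
have := integral_affine_le 1%:M (- b)%R
  (measurableT_comp mf (measurable_affine 1%:M b)) (fun=> f0 _).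
rewrite det1 normr1 mul1e; apply: le_trans.
rewrite le_eqVlt; apply/orP; left; apply/eqP; apply: eq_integral => x _ /=.
by rewrite affine_comp !mul1mx addNr /affine mul1mx addr0 vecK.
Qed.

End linear.

(** * Squared norms and normal vectors *)

Section sqn.
Context {R : realType}.

Definition sqn n (v : 'cV[R]_n) : R := (v^T *m v) ord0 ord0.

Lemma sqnE n (v : 'cV[R]_n) : sqn v = \sum_j v j ord0 ^+ 2.
Proof. by rewrite /sqn mxE; apply: eq_bigr => j _; rewrite mxE. Qed.

Lemma sqn_ge0 n (v : 'cV[R]_n) : 0 <= sqn v.
Proof. by rewrite sqnE sumr_ge0// => j _; rewrite sqr_ge0. Qed.

Lemma sqn_eq0 n (v : 'cV[R]_n) : sqn v = 0 -> v = 0.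
Proof.
rewrite sqnE => /eqP; rewrite psumr_eq0; last by move=> j _; exact: sqr_ge0.
move=> /allP h; apply/matrixP => j k; rewrite (ord1 k) mxE.
have := h j (mem_index_enum _); rewrite /= => /eqP/eqP.
by rewrite sqrf_eq0 => /eqP.
Qed.

Lemma sqnN n (v : 'cV[R]_n) : sqn (- v) = sqn v.
Proof. by rewrite !sqnE; apply: eq_bigr => j _; rewrite mxE sqrrN. Qed.

Lemma dotC n (u v : 'cV[R]_n) : (u^T *m v) ord0 ord0 = (v^T *m u) ord0 ord0.
Proof. by rewrite -[in RHS](trmxK u) -trmx_mul [in RHS]mxE. Qed.

Let entryD (A B : 'M[R]_1) : (A + B) ord0 ord0 = A ord0 ord0 + B ord0 ord0.
Proof. by rewrite mxE. Qed.

Let entryN (A : 'M[R]_1) : (- A) ord0 ord0 = - A ord0 ord0.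
Proof. by rewrite mxE. Qed.

Let entryZ a (A : 'M[R]_1) : (a *: A) ord0 ord0 = a * A ord0 ord0.
Proof. by rewrite mxE. Qed.

Lemma sqnB n (u v : 'cV[R]_n) :
  sqn (u - v) = sqn u - 2 * (v^T *m u) ord0 ord0 + sqn v.
Proof.
rewrite /sqn (_ : (u - v)^T = u^T - v^T); last by apply/matrixP => i j; rewrite !mxE.
rewrite mulmxBl !mulmxBr !(entryD, entryN) (dotC u v); ring.
Qed.

Lemma sqnZD n (a : R) (u v : 'cV[R]_n) : (u^T *m v) ord0 ord0 = 0 ->
  sqn (a *: u + v) = a ^+ 2 * sqn u + sqn v.
Proof.
move=> uv; rewrite /sqn (_ : (a *: u + v)^T = a *: u^T + v^T); last first.
  by apply/matrixP => i j; rewrite !mxE.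
rewrite mulmxDl !mulmxDr -!scalemxAl -!scalemxAr.
rewrite !(entryD, entryZ) (dotC v u) uv; ring.
Qed.
End sqn.

Section cross_product.
Context {R : realType}.
Variables (m : nat) (D : 'M[R]_(m, 1 + m)).

(** The generalized cross product of the rows of D; the cofactors along the
    first row are the same for every choice of that row, here 0. *)
Definition normal : 'rV[R]_(1 + m) := \row_j cofactor (col_mx 0 D) ord0 j.

Lemma det_normal (r : 'rV[R]_(1 + m)) :
  \det (col_mx r D) = (r *m normal^T) ord0 ord0.
Proof.
rewrite (expand_det_row _ ord0) mxE; apply: eq_bigr => j _.
rewrite [normal^T _ _]mxE [normal _ _]mxE /cofactor.
have -> : col_mx r D ord0 j = r ord0 j.
  by rewrite mxE; case: splitP => // k _; rewrite (ord1 k).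
congr (_ * (_ * _)); congr (\det _).
apply/matrixP => i k; rewrite !mxE.
case: splitP => // l /= li.
by have := ord1 l => l0; rewrite l0 /= /bump in li.
Qed.

Lemma mul_normal : D *m normal^T = 0.
Proof.
apply/matrixP => i j; rewrite (ord1 j) [RHS]mxE.
have := det_normal (row i D).
rewrite (determinant_alternate (i1 := lshift m ord0) (i2 := rshift 1 i)).
- by rewrite -row_mul [X in _ = X -> _]mxE => <-.
- by rewrite eq_lrshift.
- by move=> k; rewrite col_mxEu col_mxEd mxE.
Qed.

(** Subtracting the first row of A from the others. *)
Lemma det_sub_first_row (A : 'M[R]_(1 + m)) (r : 'rV[R]_(1 + m)) :
  usubmx A = r -> dsubmx A = D + const_mx 1 *m r ->
  \det A = \det (col_mx r D).
Proof.
move=> Au Ad; rewrite -(vsubmxK A) Au Ad.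
rewrite (_ : col_mx r (_ + _) = block_mx 1%:M 0 (const_mx 1) 1%:M *m col_mx r D).
  by rewrite det_mulmx det_lblock !det1 !mul1r.
by rewrite mul_block_col !mul1mx mul0mx addr0 addrC.
Qed.

Let M := col_mx normal D.
Let q := sqn normal^T.

Lemma det_normal_frame : \det M = q.
Proof. by rewrite det_normal /q /sqn trmxK. Qed.

Hypothesis q0 : q != 0.

Let Munit : M \in unitmx.
Proof. by rewrite unitmxE det_normal_frame unitfE. Qed.

(** The coordinates of a vector x in the frame M are s = normal . x and
    w = D x. The next lemmas say how x depends on (s, w): the part of x coming
    from s is along the normal, the part coming from w is orthogonal to it, and
    so s contributes s^2 / q to the squared norm. *)
Lemma invmx_frame_tangent (w : 'cV[R]_m) :
  (normal *m (invmx M *m col_mx 0 w)) ord0 ord0 = 0 :> R.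
Proof.
have : M *m (invmx M *m col_mx 0 w) = col_mx (0 : 'cV[R]_1) w by rewrite mulKVmx.
by rewrite mul_col_mx => /eq_col_mx[-> _]; rewrite mxE.
Qed.

Lemma frame_row (z : 'cV[R]_(1 + m)) i :
  (D *m (invmx M *m z)) i ord0 = z (rshift 1 i) ord0 :> R.
Proof.
have : M *m (invmx M *m z) = z by rewrite mulKVmx.
by rewrite -[X in _ = X]vsubmxK mul_col_mx => /eq_col_mx[_ ->]; rewrite mxE.
Qed.

Lemma invmx_frameE (s : R) (w : 'cV[R]_m) :
  invmx M *m col_mx s%:M w = (s / q) *: normal^T + invmx M *m col_mx 0 w.
Proof.
have -> : normal^T = invmx M *m col_mx q%:M 0.
  rewrite (_ : col_mx _ _ = M *m normal^T) ?mulKmx// mul_col_mx mul_normal.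
  by congr col_mx; rewrite [RHS]mx11_scalar /q /sqn trmxK.
rewrite scalemxAr -mulmxDr scale_col_mx add_col_mx scaler0 addr0 add0r.
by rewrite scale_scalar_mx mulfVK.
Qed.

Lemma sqn_frame (s : R) (w : 'cV[R]_m) :
  sqn (invmx M *m col_mx s%:M w) = s ^+ 2 / q + sqn (invmx M *m col_mx 0 w).
Proof.
rewrite invmx_frameE sqnZD ?trmxK ?invmx_frame_tangent// -/q.
by congr (_ + _); field.
Qed.

End cross_product.

(** * Integrating over the common points of spheres *)

Section spheres.
Context {R : realType}.
Local Notation mu := (@lebesgue_measure R).
Local Notation TR := (measurableTypeR R).
Local Open Scope ereal_scope.

Lemma emeasurable_prod d (T : measurableType d) n (F : 'I_n -> T -> \bar R) :
  (forall i, measurable_fun [set: T] (F i)) ->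
  measurable_fun [set: T] (fun x => \prod_(i < n) F i x).
Proof.
elim: n F => [|n IH] F mF.
  under eq_fun do rewrite big_ord0; exact: measurable_cst.
under eq_fun do rewrite big_ord_recl.
by apply: emeasurable_funM => //; exact: IH.
Qed.

Lemma integral_leb_prod n (k : 'I_n -> TR -> \bar R) :
  (forall i, measurable_fun [set: TR] (k i)) -> (forall i u, 0 <= k i u) ->
  \int[leb n]_w \prod_(i < n) k i (tnth w i) = \prod_(i < n) \int[mu]_u k i u.
Proof.
elim: n k => [|n IH] k mk k0; first by rewrite integral_leb0 !big_ord0.
rewrite integral_lebS; last 2 first.
- apply: emeasurable_prod => i.
  exact: (measurableT_comp (mk i) (@measurable_tnth _ _ _ i)).
- by move=> x; apply: prode_ge0 => i _; exact: k0.
rewrite big_ord_recl -IH//.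
rewrite -ge0_integralZr//; last first.
  by apply: integral_ge0 => z _; apply: prode_ge0 => i _; exact: k0.
apply: eq_integral => s _; rewrite -ge0_integralZl//; last 2 first.
- apply: emeasurable_prod => i.
  exact: (measurableT_comp (mk _) (@measurable_tnth _ _ _ i)).
- by move=> z _; apply: prode_ge0 => i _; exact: k0.
apply: eq_integral => z _; rewrite big_ord_recl; congr (_ * _).
by apply: eq_bigr => i _; rewrite tnthS.
Qed.

Lemma lee_prod n (F G : 'I_n -> \bar R) :
  (forall i, 0 <= F i) -> (forall i, F i <= G i) ->
  \prod_(i < n) F i <= \prod_(i < n) G i.
Proof.
move=> F0 FG; suff /andP[] : 0 <= \prod_(i < n) F i <= \prod_(i < n) G i by [].
elim/big_ind2 : _ => [|x1 x2 y1 y2 /andP[? ?] /andP[? ?]|i _].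
- by rewrite lee_fin ler01 lexx.
- by rewrite mule_ge0//= lee_pmul.
- by rewrite F0 FG.
Qed.

Definition simplex_mx k (ts : k.-tuple (euclid R k)) (x : euclid R k) : 'M[R]_k :=
  \matrix_(i, j) ((tnth (tnth ts i) j : R) - tnth x j)%R.

Definition sqdist k (x y : euclid R k) : R := sqn (vec x - vec y)%R.

Lemma measurable_sqn d (T : measurableType d) n (v : T -> 'cV[R]_n) :
  (forall i, measurable_fun [set: T] (fun t => v t i ord0)) ->
  measurable_fun [set: T] (fun t => sqn (v t)).
Proof.
move=> mv; under eq_fun do rewrite sqnE.
by apply: measurable_sum => i; exact: measurable_funX.
Qed.

(** The centres ps are fixed, with differences Delta to the first one; q = 0
    means that the centres are affinely dependent. *)
Section fixed_centres.
Variables (m : nat) (ps : m.+1.-tuple (euclid R m.+1)).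
Variables (h : 'I_m.+1 -> TR -> \bar R) (c : R).
Hypothesis mh : forall i, measurable_fun [set: TR] (h i).
Hypothesis h0 : forall i u, 0 <= h i u.

Let p i : 'cV[R]_(1 + m) := vec (tnth ps i).
Let Delta (i : 'I_m.+1) : 'cV[R]_(1 + m) := (p i - p ord0)%R.
Let D : 'M[R]_(m, 1 + m) := \matrix_(i, j) Delta (lift ord0 i) j ord0.
Let q := sqn (normal D)^T.
Let M := col_mx (normal D) D.
Let N := invmx M.

Let Delta0 : Delta ord0 = 0%R.
Proof. exact: subrr. Qed.

Let D_row i (v : 'cV[R]_(1 + m)) :
  ((Delta (lift ord0 i))^T *m v) ord0 ord0 = (D *m v) i ord0.
Proof. by rewrite !mxE; apply: eq_bigr => j _; rewrite !mxE. Qed.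

Let det_simplex x : `|\det (simplex_mx ps x)|%R
  = `|(normal D *m (vec x - p ord0)) ord0 ord0|%R.
Proof.
rewrite (@det_sub_first_row _ _ D (simplex_mx ps x : 'M[R]_(1 + m))
  (- (vec x - p ord0)^T)%R).
- rewrite det_normal mulNmx mxE normrN -trmx_mul mxE//.
- apply/matrixP => i j; rewrite !mxE (ord1 i) opprB.
  by rewrite (_ : lshift m ord0 = ord0)//; exact/val_inj.
- apply/matrixP => i j; rewrite !mxE big_ord1 !mxE.
  rewrite (_ : rshift 1 i = lift (@ord0 m) i); last exact/val_inj.
  by ring.
Qed.

Let H (z : 'cV[R]_(1 + m)) : \bar R :=
  \prod_(i < m.+1) h i (c + sqn (N *m z - Delta i))%R.

Let G (z : euclid R m.+1) : \bar R := `|tnth z ord0 : R|%:E * H (vec z).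

Let mG : measurable_fun [set: _] G.
Proof.
apply: emeasurable_funM.
  apply/measurable_EFinP; apply: measurableT_comp => //; exact: measurable_tnth.
apply: emeasurable_prod => i; apply: (measurableT_comp (mh i)).
apply: measurable_funD => //; apply: measurable_sqn => j.
under eq_fun do rewrite mxE; apply: measurable_funD => //.
  by apply: measurable_mulmx => k//; exact: measurable_vec.
Qed.

Let G0 z : 0 <= G z.
Proof. by rewrite mule_ge0// prode_ge0. Qed.

(* In the coordinates (s, w), the product of the h i as a function of w and of
   the squared distance u to the first centre (shifted by c). *)
Let W (w : euclid R m) (u : R) : \bar R := h ord0 u *
  \prod_(i < m) h (lift ord0 i) (u - 2 * (tnth w i : R) + sqn (Delta (lift ord0 i)))%R.

Let mW : measurable_fun [set: _] (fun z : euclid R m * TR => W z.1 z.2).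
Proof.
apply: emeasurable_funM; first exact: (measurableT_comp (mh _)).
apply: emeasurable_prod => i; apply: (measurableT_comp (mh _)).
apply: measurable_funD => //; apply: measurable_funB => //.
apply: measurable_funM => //.
exact: (measurableT_comp (@measurable_tnth _ _ _ i)).
Qed.

Let W0 w u : 0 <= W w u.
Proof. by rewrite mule_ge0// prode_ge0. Qed.

Let G_slice (q0 : q != 0%R) (s : TR) w : G (tcons (s, w)) =
  `|s : R|%:E * W w ((s : R) ^+ 2 / q + (c + sqn (N *m col_mx 0 (vec w))))%R.
Proof.
rewrite /G; congr (_ * _).
rewrite /H vec_tcons big_ord_recl Delta0 subr0 (sqn_frame q0) /W.
congr (h _ _ * _); first by ring.
apply: eq_bigr => i _; congr (h _ _).
rewrite sqnB D_row (frame_row q0) (sqn_frame q0) col_mxEd mxE; ring.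
Qed.

Let int_W : \int[leb m]_w \int[mu]_u W w u <= \prod_(i < m.+1) \int[mu]_u h i u.
Proof.
rewrite (tonelli_swap _ _ mW)// big_ord_recl -ge0_integralZr//; last first.
  by apply: prode_ge0 => i _; exact: integral_ge0.
apply: ge0_le_integral => //.
- by move=> u _; exact: integral_ge0.
- exact: (measurable_intl _ mW).
- apply: emeasurable_funM => //; exact: measurable_cst.
move=> u _.
have mhu i : measurable_fun [set: TR]
    (fun w : TR => h (lift ord0 i) (u - 2 * (w : R) + sqn (Delta (lift ord0 i)))%R).
  apply: (measurableT_comp (mh _)).
  by apply: measurable_funD => //; apply: measurable_funB => //; exact: measurable_funM.
rewrite /W ge0_integralZl//; last 2 first.
- apply: emeasurable_prod => i.
  exact: (measurableT_comp (mhu i) (@measurable_tnth _ _ _ i)).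
- by move=> w _; exact: prode_ge0.
apply: lee_wpmul2l => //.
rewrite (integral_leb_prod (k := fun i w =>
  h (lift ord0 i) (u - 2 * (w : R) + sqn (Delta (lift ord0 i)))%R))//.
apply: lee_prod => i; first exact: integral_ge0.
rewrite -(@ge0_integral_affine _ (-2)%R (u + sqn (Delta (lift ord0 i)))%R _ _
  (mh _) (h0 _)); last first.
  by rewrite oppr_eq0 pnatr_eq0.
rewrite (_ : (fun w => _) = (fun s => h (lift ord0 i)
    (- 2 * s + (u + sqn (Delta (lift ord0 i))))%R)); last first.
  by apply/funext => s; congr (h _ _); ring.
apply: lee_pemull; first exact: integral_ge0.
by rewrite lee_fin normrN ger0_norm// ler1n.
Qed.

(** The map x |-> (|x - p_i|^2)_i has Jacobian a multiple of
    det(p_i - x), so this is a change of variables in which each value is taken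
    at most twice. It is carried out in the coordinates (s, w) of the frame
    M = (normal, D) centred at p_0: there |det| is |s|, the squared distance to
    p_0 is s^2 / q plus a function of w, and passing to another centre subtracts
    2 w_i up to a constant. *)
Lemma integral_spheres_le :
  \int[leb m.+1]_x (`|\det (simplex_mx ps x)|%:E *
     \prod_(i < m.+1) h i (c + sqdist (tnth ps i) x)%R)
  <= \prod_(i < m.+1) \int[mu]_u h i u.
Proof.
have [q0|q0] := eqVneq q 0%R.
  rewrite (_ : \int[_]_x _ = 0).
    by apply: prode_ge0 => i _; exact: integral_ge0.
  rewrite -[RHS](integral0 (leb m.+1) setT); apply: eq_integral => x _.
  by rewrite det_simplex -[normal D]trmxK (sqn_eq0 q0) trmx0 mul0mx mxE normr0 mul0e.
have qgt0 : (0 < q)%R by rewrite lt_neqAle eq_sym q0 sqn_ge0.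
rewrite -(@lee_pmul2l _ q%:E)//.
pose b : 'cV[R]_m.+1 := (- (M *m p ord0))%R.
have xE x : vec (affine (M : 'M[R]_m.+1) b x) = (M *m (vec x - p ord0))%R.
  by rewrite /affine tupK mulmxBr.
apply: le_trans (_ : \int[leb m.+1]_z G z <= _).
  have := integral_affine_le (M : 'M[R]_m.+1) b mG G0.
  rewrite (_ : \det M = q) ?det_normal_frame//.
  rewrite gtr0_norm//; move=> /(le_trans _); apply.
  rewrite le_eqVlt; apply/orP; left; apply/eqP; congr (_ * _).
  apply: eq_integral => x _; rewrite det_simplex /G.
  congr (_%:E * _).
    rewrite (_ : tnth (affine _ b x) ord0 = vec (affine M b x) ord0 ord0); last first.
      by rewrite mxE.
    rewrite xE mul_col_mx [X in _ = `|X|%R]mxE.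
    by case: splitP => // k _; rewrite (ord1 k).
  rewrite /H; apply: eq_bigr => i _; congr (h _ (_ + _)%R).
  rewrite xE mulKmx ?unitmxE ?det_normal_frame ?unitfE//.
  by rewrite -sqnN /Delta; congr sqn; rewrite !opprB addrA subrK.
rewrite integral_lebS_swap//.
apply: le_trans (_ : \int[leb m]_w (q%:E * \int[mu]_u W w u) <= _).
  apply: ge0_le_integral => //.
  - by move=> w _; exact: integral_ge0.
  - exact: (measurable_int_slice mG G0).
  - by apply: emeasurable_funM => //; exact: (measurable_intr _ mW).
  move=> w _; under eq_integral do rewrite (G_slice q0).
  apply: (@ge0_integral_sqr_le _ _ _ (W w)) => //.
  exact: (measurableT_comp mW (measurable_pair1 w)).
rewrite ge0_integralZl//; last 3 first.
- exact: (measurable_intr _ mW).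
- by move=> w _; exact: integral_ge0.
- by rewrite lee_fin ltW.
by rewrite lee_pmul2l.
Qed.

End fixed_centres.

End spheres.

(** * Iterated weighted integrals *)

Section iterated.
Local Open Scope ereal_scope.
Context d (T : measurableType d) (R : realType).
Variable m : {sigma_finite_measure set T -> \bar R}.

(** The integral of H(t_1, ..., t_k) f(t_1) ... f(t_k) over T^k. The first entry
    of the tuple is integrated innermost, so that it can be estimated with the
    other entries fixed. *)
Fixpoint wint (f : T -> \bar R) k : (k.-tuple T -> \bar R) -> \bar R :=
  match k with
  | 0 => fun H => H [tuple]
  | _.+1 => fun H => wint f (fun ts => \int[m]_t (f t * H [tuple of t :: ts]))
  end.

Lemma wint_ge0 f k (H : k.-tuple T -> \bar R) :
  (forall t, 0 <= f t) -> (forall ts, 0 <= H ts) -> 0 <= wint f H.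
Proof.
move=> f0; elim: k H => [|k IH] H H0 /=; first exact: H0.
by apply: IH => ts; apply: integral_ge0 => t _; rewrite mule_ge0.
Qed.

Section measurability.
Context d' (Z : measurableType d').

Lemma measurable_wint_inner k (f : Z -> T -> \bar R)
    (H : Z -> k.+1.-tuple T -> \bar R) :
  measurable_fun [set: Z * T] (fun p => f p.1 p.2) ->
  measurable_fun [set: Z * k.+1.-tuple T] (fun p => H p.1 p.2) ->
  measurable_fun [set: (Z * k.-tuple T) * T]
    (fun p => f p.1.1 p.2 * H p.1.1 [tuple of p.2 :: p.1.2]).
Proof.
move=> mf mH; apply: emeasurable_funM.
  apply: (measurableT_comp mf (g := fun p : (Z * k.-tuple T) * T => (p.1.1, p.2))).
  by apply: measurable_fun_pair => //; exact: measurableT_comp.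
apply: (measurableT_comp mH (g := fun p : (Z * k.-tuple T) * T =>
  (p.1.1, [tuple of p.2 :: p.1.2]))).
apply: measurable_fun_pair => //; first exact: measurableT_comp.
by apply: measurable_cons => //; exact: measurableT_comp.
Qed.

Lemma measurable_wint k (f : Z -> T -> \bar R) (H : Z -> k.-tuple T -> \bar R) :
  measurable_fun [set: Z * T] (fun p => f p.1 p.2) ->
  measurable_fun [set: Z * k.-tuple T] (fun p => H p.1 p.2) ->
  (forall z t, 0 <= f z t) -> (forall z ts, 0 <= H z ts) ->
  measurable_fun [set: Z] (fun z => wint (f z) (H z)).
Proof.
move=> mf + f0; elim: k H => [|k IH] H mH H0 /=.
  exact: (measurableT_comp mH (measurable_pair2 [tuple])).
apply: (IH (fun z ts => \int[m]_t (f z t * H z [tuple of t :: ts]))).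
  exact: (measurable_intr m (measurable_wint_inner mf mH)
    (fun p t => mule_ge0 (f0 p.1 t) (H0 p.1 _))).
by move=> z ts; apply: integral_ge0 => t _; rewrite mule_ge0.
Qed.

End measurability.

Section monotonicity.
Variable f : T -> \bar R.
Hypotheses (mf : measurable_fun [set: T] f) (f0 : forall t, 0 <= f t).

Lemma measurable_inner k (H : k.+1.-tuple T -> \bar R) :
  measurable_fun [set: _] H ->
  measurable_fun [set: k.-tuple T * T]
    (fun p => f p.2 * H [tuple of p.2 :: p.1]).
Proof.
move=> mH; apply: emeasurable_funM; first exact: (measurableT_comp mf).
apply: (measurableT_comp mH (g := fun p : k.-tuple T * T => [tuple of p.2 :: p.1])).
exact: measurable_cons.
Qed.

Lemma measurable_inner1 k (H : k.+1.-tuple T -> \bar R) (ts : k.-tuple T) :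
  measurable_fun [set: _] H ->
  measurable_fun [set: T] (fun t => f t * H [tuple of t :: ts]).
Proof.
by move=> mH; exact: (measurableT_comp (measurable_inner mH) (measurable_pair1 ts)).
Qed.

Lemma measurable_inner_int k (H : k.+1.-tuple T -> \bar R) :
  measurable_fun [set: _] H -> (forall ts, 0 <= H ts) ->
  measurable_fun [set: _] (fun ts : k.-tuple T => \int[m]_t (f t * H [tuple of t :: ts])).
Proof.
move=> mH H0; exact: (measurable_intr m (measurable_inner mH)
   (fun p t => mule_ge0 (f0 t) (H0 _))).
Qed.

Lemma le_wint k (H H' : k.-tuple T -> \bar R) :
  measurable_fun [set: _] H -> measurable_fun [set: _] H' ->
  (forall ts, 0 <= H ts) -> (forall ts, H ts <= H' ts) -> wint f H <= wint f H'.
Proof.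
elim: k H H' => [|k IH] H H' mH mH' H0 HH' /=; first exact: HH'.
have H'0 ts : 0 <= H' ts by exact: le_trans (HH' _).
apply: IH => [|||ts]; [exact: measurable_inner_int..| |].
  by move=> ts; apply: integral_ge0 => t _; rewrite mule_ge0.
apply: ge0_le_integral => //.
- by move=> t _; rewrite mule_ge0.
- exact: measurable_inner1.
- exact: measurable_inner1.
- by move=> t _; rewrite lee_wpmul2l.
Qed.

Lemma wintZl k (H : k.-tuple T -> \bar R) c :
  measurable_fun [set: _] H -> (forall ts, 0 <= H ts) -> 0 <= c ->
  wint f (fun ts => c * H ts) = c * wint f H.
Proof.
elim: k H => [//|k IH] H mH H0 c0 /=.
rewrite -IH//; last 2 first.
- exact: measurable_inner_int.
- by move=> ts; apply: integral_ge0 => t _; rewrite mule_ge0.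
congr wint; apply/funext => ts; rewrite -ge0_integralZl//.
- by apply: eq_integral => t _; rewrite muleCA.
- exact: measurable_inner1.
- by move=> t _; rewrite mule_ge0.
Qed.

End monotonicity.

Lemma le_wint_weight (f g : T -> \bar R) k (H : k.-tuple T -> \bar R) :
  measurable_fun [set: T] f -> measurable_fun [set: T] g ->
  (forall t, 0 <= f t) -> (forall t, f t <= g t) ->
  measurable_fun [set: _] H -> (forall ts, 0 <= H ts) ->
  wint f H <= wint g H.
Proof.
move=> mf mg f0 fg; have g0 t : 0 <= g t by exact: le_trans (fg t).
elim: k H => [//|k IH] H mH H0 /=.
apply: le_trans (_ : wint f (fun ts => \int[m]_t (g t * H [tuple of t :: ts])) <= _).
  apply: le_wint => // [||ts|ts]; [exact: measurable_inner_int..| |].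
    by apply: integral_ge0 => t _; rewrite mule_ge0.
  apply: ge0_le_integral => //.
  - by move=> t _; rewrite mule_ge0.
  - exact: measurable_inner1.
  - exact: measurable_inner1.
  - by move=> t _; rewrite lee_wpmul2r.
apply: IH; first exact: measurable_inner_int.
by move=> ts; apply: integral_ge0 => t _; rewrite mule_ge0.
Qed.

Section exchange.
Context d' (Z : measurableType d').
Variable n : {sigma_finite_measure set Z -> \bar R}.
Variables (f : Z -> T -> \bar R) (g : T -> \bar R).
Hypotheses (mf : measurable_fun [set: Z * T] (fun p => f p.1 p.2)).
Hypotheses (mg : measurable_fun [set: T] g).
Hypotheses (f0 : forall z t, 0 <= f z t) (g0 : forall t, 0 <= g t).

(** Integrating over z first. If the inner integral over z is bounded by a
    product of functions of the single entries, the remaining integral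
    factors. *)
Lemma integral_wint_le k (H : Z -> k.-tuple T -> \bar R) (C : \bar R) :
  measurable_fun [set: Z * k.-tuple T] (fun p => H p.1 p.2) ->
  (forall z ts, 0 <= H z ts) -> 0 <= C ->
  (forall ts, \int[n]_z (\prod_(i < k) f z (tnth ts i) * H z ts)
     <= C * \prod_(i < k) g (tnth ts i)) ->
  \int[n]_z wint (f z) (H z) <= C * (\int[m]_t g t) ^+ k.
Proof.
elim: k H C => [|k IH] H C mH H0 C0 fHg.
  have := fHg [tuple]; rewrite big_ord0 expe0.
  by under eq_integral do rewrite big_ord0 mul1e.
rewrite expeS muleA.
have gint0 : 0 <= \int[m]_t g t by exact: integral_ge0.
have mI := measurable_wint_inner mf mH.
have I0 (p : Z * k.-tuple T) t : 0 <= f p.1 t * H p.1 [tuple of t :: p.2].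
  by rewrite mule_ge0.
apply: (IH (fun z ts => \int[m]_t (f z t * H z [tuple of t :: ts]))).
- exact: (measurable_intr m mI I0).
- by move=> z ts; apply: integral_ge0 => t _; rewrite mule_ge0.
- by rewrite mule_ge0.
move=> ts.
have mfi i : measurable_fun [set: Z] (fun z => f z (tnth ts i)).
  exact: (measurableT_comp mf (measurable_pair2 (tnth ts i))).
have mJ : measurable_fun [set: Z * T] (fun p => f p.1 p.2 * H p.1 [tuple of p.2 :: ts]).
  apply: (measurableT_comp mI (g := fun p : Z * T => ((p.1, ts), p.2))).
  by apply: measurable_fun_pair => //; exact: measurable_fun_pair.
pose G z t := \prod_(i < k) f z (tnth ts i) * (f z t * H z [tuple of t :: ts]).
have mG : measurable_fun [set: Z * T] (fun p => G p.1 p.2).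
  apply: emeasurable_funM => //; apply: emeasurable_prod => i.
  exact: (measurableT_comp (mfi i)).
have G0 z t : 0 <= G z t by rewrite mule_ge0 ?prode_ge0// mule_ge0.
have -> : \int[n]_z (\prod_(i < k) f z (tnth ts i) *
    \int[m]_t (f z t * H z [tuple of t :: ts])) = \int[n]_z \int[m]_t G z t.
  apply: eq_integral => z _; rewrite ge0_integralZl ?prode_ge0//.
  - exact: (measurableT_comp mJ (measurable_pair1 z)).
  - by move=> t _; rewrite mule_ge0.
rewrite (tonelli_swap _ _ mG)// -muleA muleC.
rewrite -muleA -ge0_integralZr//; last by rewrite mule_ge0// prode_ge0.
apply: ge0_le_integral => //.
- by move=> t _; exact: integral_ge0.
- exact: (measurable_intl n mG).
- by apply: emeasurable_funM => //; exact: measurable_cst.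
move=> t _.
have := fHg [tuple of t :: ts]; rewrite big_ord_recl.
rewrite (_ : C * _ = g t * (\prod_(i < k) g (tnth ts i) * C)); last first.
  rewrite muleC -muleA; congr (_ * (_ * _)).
  by apply: eq_bigr => i _; rewrite tnthS.
apply: le_trans; rewrite le_eqVlt; apply/orP; left; apply/eqP.
apply: eq_integral => z _; rewrite big_ord_recl /G muleCA muleA; congr (_ * _ * _).
by apply: eq_bigr => i _; rewrite tnthS.
Qed.

End exchange.
End iterated.

(** * A large mass spans large simplices *)

Section slice.
Context {R : realType}.
Local Notation mu := (@lebesgue_measure R).
Local Notation TR := (measurableTypeR R).
Local Open Scope ereal_scope.

(** Where |s - s0| < r, phi is at most lam; elsewhere 1 <= |s - s0| / r. *)
Lemma integral_le_near_far (phi : TR -> \bar R) (lam r s0 : R) :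
  measurable_fun [set: TR] phi -> (forall s, 0 <= phi s <= lam%:E) ->
  (0 < r)%R ->
  \int[mu]_s phi s <= (2 * r * lam)%:E
     + (r^-1)%:E * \int[mu]_s (phi s * `|(s : R) - s0|%:E).
Proof.
move=> mphi philam r0.
have phi0 s : 0 <= phi s by have /andP[] := philam s.
have lam0 : (0 <= lam)%R.
  by have /andP[h1 h2] := philam 0%R; have := le_trans h1 h2; rewrite lee_fin.
pose I : set TR := [set` `]s0 - r, s0 + r[%R].
have mI : measurable I by exact: measurable_itv.
have mabs : measurable_fun [set: TR] (fun s : TR => `|(s : R) - s0|%R).
  by apply: measurableT_comp => //; exact: measurable_funB.
have mpa : measurable_fun [set: TR] (fun s : TR => phi s * `|(s : R) - s0|%:E).
  by apply: emeasurable_funM => //; exact/measurable_EFinP.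
rewrite (_ : (2 * r * lam)%:E = \int[mu]_s (lam * \1_I s)%:E); last first.
  under eq_integral do rewrite EFinM.
  rewrite ge0_integralZl ?lee_fin//; last exact/measurable_EFinP.
  rewrite integral_indic// setIT /I [X in _ * X]lebesgue_measure_itv/= lte_fin.
  rewrite ltrBlDr -addrA ltrDl addr_gt0// -EFinB -EFinM; congr EFin; ring.
rewrite -ge0_integralZl//; last 2 first.
- by move=> s _; rewrite mule_ge0.
- by rewrite lee_fin invr_ge0 ltW.
rewrite -ge0_integralD//; last 4 first.
- by move=> s _; rewrite lee_fin mulr_ge0.
- by apply/measurable_EFinP; apply: measurable_funM.
- by move=> s _; rewrite mule_ge0 ?mule_ge0// lee_fin invr_ge0 ltW.
- exact: emeasurable_funM.
apply: ge0_le_integral => //.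
  apply: emeasurable_funD; last exact: emeasurable_funM.
  by apply/measurable_EFinP; apply: measurable_funM.
move=> s _; have [sI|sI] := boolP (s \in I).
  rewrite indicE sI mulr1; have /andP[_ h] := philam s.
  by rewrite (le_trans h)// leeDl// mule_ge0 ?mule_ge0// lee_fin invr_ge0 ltW.
rewrite indicE (negbTE sI) mulr0 add0e muleCA lee_pemulr// -EFinM lee_fin.
rewrite ler_pdivlMl// mulr1 leNgt; apply: contra sI.
rewrite ltr_norml => /andP[h1 h2]; rewrite inE /I/= in_itv/=; apply/andP; split; lra.
Qed.

(** A function with values in [0, lam] cannot put its mass where an affine
    function is small. Choosing r = F / (4 lam) in [integral_le_near_far], with F
    the integral of phi, makes the near part half of F. *)
Lemma slice_moment_lower (phi : TR -> \bar R) (lam a b : R) :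
  measurable_fun [set: TR] phi -> (forall s, 0 <= phi s <= lam%:E) ->
  (0 < lam)%R ->
  `|a|%:E * (\int[mu]_s phi s) ^+ 2 <=
  (8 * lam)%:E * \int[mu]_s (phi s * `|a * (s : R) + b|%:E).
Proof.
move=> mphi philam lam0.
have phi0 s : 0 <= phi s by have /andP[] := philam s.
have [->|a0] := eqVneq a 0%R.
  rewrite normr0 mul0e; apply: mule_ge0; first by rewrite lee_fin mulr_ge0// ltW.
  by apply: integral_ge0 => s _; rewrite mule_ge0.
pose s0 := (- b / a)%R.
have mabs : measurable_fun [set: TR] (fun s : TR => `|(s : R) - s0|%R).
  by apply: measurableT_comp => //; exact: measurable_funB.
have mpa : measurable_fun [set: TR] (fun s : TR => phi s * `|(s : R) - s0|%:E).
  by apply: emeasurable_funM => //; exact/measurable_EFinP.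
have -> : \int[mu]_s (phi s * `|a * (s : R) + b|%:E)
   = `|a|%:E * \int[mu]_s (phi s * `|(s : R) - s0|%:E).
  rewrite -ge0_integralZl//; last by move=> s _; rewrite mule_ge0.
  apply: eq_integral => s _; rewrite muleCA -EFinM -normrM /s0.
  by congr (_ * `|_|%:E); field.
rewrite [X in _ <= X]muleCA lee_pmul2l ?lte_fin ?normr_gt0//.
have := fun r => @integral_le_near_far phi lam r s0 mphi philam.
set F := \int[mu]_s phi s; set I := \int[mu]_s _ => FI.
have F0 : 0 <= F by exact: integral_ge0.
have I0 : 0 <= I by apply: integral_ge0 => s _; rewrite mule_ge0.
case: I I0 FI => [I| |//]; last first.
  by move=> _ _; rewrite gt0_muley ?leey// lte_fin mulr_gt0.
rewrite lee_fin => I0 FI.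
have : F \is a fin_num.
  rewrite ge0_fin_numE//; apply: le_lt_trans (FI 1%R ltr01) _.
  by rewrite invr1 mul1e -EFinD ltry.
case: F F0 FI => [F|//|//] + FI _; rewrite lee_fin le_eqVlt => /predU1P[<-|F0].
  by rewrite -EFin_expe expr0n lee_fin mulr_ge0// mulr_ge0// ltW.
have := FI (F / (4 * lam))%R; rewrite divr_gt0 ?mulr_gt0// => /(_ isT).
rewrite -EFin_expe -!EFinM -EFinD !lee_fin invf_div => h.
have : (F * F <= (2 * (F / (4 * lam)) * lam + 4 * lam / F * I) * F)%R by rewrite ler_pM2r.
have -> : ((2 * (F / (4 * lam)) * lam + 4 * lam / F * I) * F = F ^+ 2 / 2 + 4 * lam * I)%R.
  by field; rewrite !gt_eqF.
rewrite -expr2 => h2; lra.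
Qed.
End slice.

Section simplices.
Context {R : realType}.
Local Notation mu := (@lebesgue_measure R).
Local Notation TR := (measurableTypeR R).
Local Open Scope ereal_scope.

Definition tail n (x : euclid R n.+1) : euclid R n := [tuple of behead x].

Lemma tail_tcons n s (z : euclid R n) : tail (tcons (s, z)) = z.
Proof. exact/val_inj. Qed.

Lemma measurable_tail n : measurable_fun [set: euclid R n.+1] (@tail n).
Proof. exact: measurable_behead. Qed.

Lemma measurable_map_tuple d1 d2 (T1 : measurableType d1) (T2 : measurableType d2)
    (g : T1 -> T2) k : measurable_fun [set: T1] g ->
  measurable_fun [set: k.-tuple T1]
    (fun ts : k.-tuple T1 => [tuple of map g ts] : k.-tuple T2).
Proof.
move=> mg; apply/measurable_fun_tnthP => i.
rewrite (_ : _ \o _ = g \o (fun ts : k.-tuple T1 => tnth ts i)).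
  exact: (measurableT_comp mg (@measurable_tnth _ _ _ i)).
by apply/funext => ts /=; rewrite tnth_map.
Qed.

(** If H does not see the first coordinates of the points, they can be
    integrated out of the weight. *)
Lemma wint_tail n (f : euclid R n.+1 -> \bar R) k (H : k.-tuple (euclid R n) -> \bar R) :
  measurable_fun [set: _] f -> (forall x, 0 <= f x) ->
  measurable_fun [set: _] H -> (forall ts, 0 <= H ts) ->
  wint (leb n.+1) f (fun ts => H [tuple of map (@tail n) ts]) =
  wint (leb n) (fun z => \int[mu]_s f (tcons (s, z))) H.
Proof.
move=> mf f0; elim: k H => [|k IH] H mH H0.
  by rewrite /=; congr H; exact/val_inj.
have mF := measurable_int_slice mf f0.
have F0 z : 0 <= \int[mu]_s f (tcons (s, z)) by exact: integral_ge0.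
rewrite /= -IH; last 2 first.
- exact: measurable_inner_int.
- by move=> ts; apply: integral_ge0 => z _; rewrite mule_ge0.
congr wint; apply/funext => ts.
rewrite integral_lebS_swap//; last 2 first.
- apply: emeasurable_funM => //; apply: (measurableT_comp mH).
  apply: (measurableT_comp (measurable_map_tuple (@measurable_tail n))).
  exact: measurable_cons.
- by move=> x; rewrite mule_ge0.
apply: eq_integral => z _; rewrite -ge0_integralZr//; last first.
  exact: (measurableT_comp (measurable_slice mf) (measurable_pair2 z)).
apply: eq_integral => s _; congr (_ * H _); apply/val_inj => /=.
by rewrite -[X in _ :: X]/(map _ _); congr (_ :: _); exact: tail_tcons.
Qed.

Lemma measurable_det d (T : measurableType d) n (A : T -> 'M[R]_n) :
  (forall i j, measurable_fun [set: T] (fun x => A x i j)) ->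
  measurable_fun [set: T] (fun x => \det (A x)).
Proof.
move=> mA; rewrite /determinant.
apply: measurable_sum => s; apply: measurable_funM => //.
exact: measurable_prod.
Qed.

Lemma measurable_simplex k :
  measurable_fun [set: euclid R k * k.-tuple (euclid R k)]
    (fun p => `|\det (simplex_mx p.2 p.1)|%:E).
Proof.
apply/measurable_EFinP; apply: measurableT_comp => //.
apply: measurable_det => i j; under eq_fun do rewrite mxE.
apply: measurable_funB.
  apply: (measurableT_comp (@measurable_tnth _ _ _ j)).
  exact: (measurableT_comp (@measurable_tnth _ _ _ i)).
exact: (measurableT_comp (@measurable_tnth _ _ _ j)).
Qed.

Lemma measurable_simplex_r k x :
  measurable_fun [set: k.-tuple (euclid R k)]
    (fun ts => `|\det (simplex_mx ts x)|%:E).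
Proof. exact: (measurableT_comp (@measurable_simplex k) (measurable_pair1 x)). Qed.

(** Laplace expansion along the first row: the first coordinate s of the first
    point occurs in one entry only, whose cofactor is the determinant of the
    projected remaining points. *)
Lemma det_simplex_cons n (x : euclid R n.+1) (z : euclid R n)
    (ts : n.-tuple (euclid R n.+1)) : exists b, forall s : TR,
  \det (simplex_mx [tuple of tcons (s, z) :: ts] x) =
  (\det (simplex_mx [tuple of map (@tail n) ts] (tail x)) * (s : R) + b)%R.
Proof.
set A := fun s => simplex_mx [tuple of tcons (s, z) :: ts] x.
have cofE s j : cofactor (A s) ord0 j = cofactor (A 0%R) ord0 j.
  rewrite /cofactor; congr (_ * \det _)%R.
  by apply/matrixP => i k; rewrite !mxE !tnthS.
have cof00 s : cofactor (A s) ord0 ord0 =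
    \det (simplex_mx [tuple of map (@tail n) ts] (tail x)).
  rewrite /cofactor expr0 mul1r; congr (\det _).
  apply/matrixP => i k; rewrite !mxE !tnthS tnth_map.
  by rewrite !(tnth_nth 0%R)/= !nth_behead.
exists (- \det (simplex_mx [tuple of map (@tail n) ts] (tail x)) * (tnth x ord0 : R) +
  \sum_(j < n) A 0%R ord0 (lift ord0 j) * cofactor (A 0%R) ord0 (lift ord0 j))%R => s.
rewrite (expand_det_row _ ord0) big_ord_recl cof00 !mxE.
rewrite (_ : tnth _ _ = s)//.
rewrite (eq_bigr (fun j => A 0%R ord0 (lift ord0 j)
    * cofactor (A 0%R) ord0 (lift ord0 j))%R); last first.
  move=> j _; rewrite cofE; congr (_ * _)%R.
  by rewrite !mxE !tnth0 !tnthS.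
ring.
Qed.
End simplices.

Section lower.
Context {R : realType}.
Local Notation mu := (@lebesgue_measure R).
Local Notation TR := (measurableTypeR R).
Local Open Scope ereal_scope.

Lemma ge0_integral_gt0 d (T : measurableType d) (m : {measure set T -> \bar R})
    (F G : T -> \bar R) :
  measurable_fun [set: T] F -> measurable_fun [set: T] G ->
  (forall x, 0 <= F x) -> (forall x, 0 <= G x) -> (forall x, G x = 0 -> F x = 0) ->
  0 < \int[m]_x F x -> 0 < \int[m]_x G x.
Proof.
move=> mF mG F0 G0 GF; rewrite !lt0e !integral_ge0// !andbT.
apply: contra => /eqP intG0.
have : \int[m]_x `|G x| = 0.
  by rewrite -[RHS]intG0; apply: eq_integral => x _; rewrite gee0_abs.
move=> /ae_eq_integral_abs => /(_ measurableT mG) aeG.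
rewrite (ge0_ae_eq_integral (g := cst 0))// ?integral0//.
by apply: filterS aeG => x /= h xT; apply: GF; exact: h.
Qed.

Lemma le_expe (x y : \bar R) n : 0 <= x -> x <= y -> x ^+ n <= y ^+ n.
Proof.
move=> x0 xy; elim: n => [|n IHn]; first by rewrite !expe0.
by rewrite !expeS lee_pmul// expe_ge0.
Qed.

Lemma expey n : (+oo : \bar R) ^+ n.+1 = +oo.
Proof. by elim: n => // n IHn; rewrite expeS IHn. Qed.

Section step.
Variables (n : nat) (f : euclid R n.+1 -> \bar R) (lam : R) (x : euclid R n.+1).
Hypotheses (mf : measurable_fun [set: _] f) (flam : forall t, 0 <= f t <= lam%:E).
Hypothesis lam0 : (0 < lam)%R.

Let f0 t : 0 <= f t. Proof. by have /andP[] := flam t. Qed.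

Let F z := \int[mu]_s f (tcons (s, z)).

Let F0 z : 0 <= F z. Proof. exact: integral_ge0. Qed.

Let mF : measurable_fun [set: _] F. Proof. exact: measurable_int_slice. Qed.

Let mF2 : measurable_fun [set: _] (fun z => F z ^+ 2).
Proof. by under eq_fun do rewrite expe2; exact: emeasurable_funM. Qed.


(** [slice_moment_lower] applied in the first coordinate of the first point,
    with the remaining points fixed. *)
Lemma wint_slice_lower :
  (\int[leb n]_z F z ^+ 2) * wint (leb n) F (fun ts => `|\det (simplex_mx ts (tail x))|%:E)
  <= (8 * lam)%:E * wint (leb n.+1) f (fun ts => `|\det (simplex_mx ts x)|%:E).
Proof.
have c0 : 0 <= (8 * lam)%:E by rewrite lee_fin mulr_ge0// ltW.
rewrite -wint_tail//; last exact: measurable_simplex_r.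
have mH : measurable_fun [set: n.-tuple (euclid R n.+1)]
   (fun ts => `|\det (simplex_mx [tuple of map (@tail R n) ts] (tail x))|%:E).
  apply: (measurableT_comp (measurable_simplex_r (tail x))).
  exact: (measurable_map_tuple (@measurable_tail R n)).
rewrite -(wintZl _ mf f0 mH)//; last by apply: integral_ge0 => z _; rewrite expe_ge0.
rewrite -(wintZl _ mf f0 (measurable_simplex_r x))//.
apply: le_wint => //.
- exact: emeasurable_funM.
- apply: (@measurable_inner_int _ _ _ (leb n.+1) f mf f0 _
    (fun ts => (8 * lam)%:E * `|\det (simplex_mx ts x)|%:E)).
    by apply: emeasurable_funM => //; exact: measurable_simplex_r.
  by move=> ts; rewrite mule_ge0.
- by move=> ts; rewrite mule_ge0// integral_ge0// => z _; rewrite expe_ge0.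
move=> ts.
under [X in _ <= X]eq_integral do rewrite muleCA.
have mfd : measurable_fun [set: euclid R n.+1]
    (fun t => f t * `|\det (simplex_mx [tuple of t :: ts] x)|%:E).
  exact: (measurable_inner1 mf ts (measurable_simplex_r x)).
have fd0 t : 0 <= f t * `|\det (simplex_mx [tuple of t :: ts] x)|%:E.
  by rewrite mule_ge0.
rewrite ge0_integralZl//.
rewrite integral_lebS_swap//.
rewrite -ge0_integralZl//; last 2 first.
- exact: (measurable_int_slice mfd fd0).
- by move=> z _; apply: integral_ge0 => s _; rewrite mule_ge0.
rewrite muleC -ge0_integralZl//; last first.
  by move=> z _; rewrite expe_ge0.
apply: ge0_le_integral => //.
- by move=> z _; rewrite mule_ge0// expe_ge0.
- exact: emeasurable_funM.
- by apply: emeasurable_funM => //; exact: (measurable_int_slice mfd fd0).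
move=> z _; have [b detE] := det_simplex_cons x z ts.
under [X in _ <= _ * X]eq_integral do rewrite detE.
apply: slice_moment_lower => //.
exact: (measurableT_comp (measurable_slice mf) (measurable_pair2 z)).
Qed.

Variable c : R.
Hypothesis c0 : (0 < c)%R.
Hypothesis IH : forall (g : euclid R n -> \bar R) (nu : R),
  measurable_fun [set: _] g -> (forall t, 0 <= g t <= nu%:E) -> (0 < nu)%R ->
  c%:E * (\int[leb n]_z g z) ^+ n.+1 <=
  nu%:E * wint (leb n) g (fun ts => `|\det (simplex_mx ts (tail x))|%:E).

(** With a and b the integrals of F and F^2, and g = min(F, nu), one has
    F <= g + F^2 / nu and hence a <= int g + b / nu. For nu = 2 b / a the
    truncation g keeps half of the mass, and the induction hypothesis for g
    combines with [wint_slice_lower] so that b cancels. If a or b is infinite,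
    nu = 1 shows that the right-hand side is infinite as well. *)
Lemma simplex_step : (c / (8 * 2 ^+ n.+2))%:E * (\int[leb n.+1]_t f t) ^+ n.+2 <=
  lam%:E * wint (leb n.+1) f (fun ts => `|\det (simplex_mx ts x)|%:E).
Proof.
have := wint_slice_lower.
rewrite EFinM -muleA integral_lebS_swap//.
set L := lam%:E * _; set D := wint (leb n) F _; set a := \int[leb n]_z F z.
set b := \int[leb n]_z _ => bDL.
have D0 : 0 <= D by exact: wint_ge0.
have L0 : 0 <= L by apply: mule_ge0; [rewrite lee_fin ltW|exact: wint_ge0].
have a0 : 0 <= a by exact: integral_ge0.
have b0 : 0 <= b by apply: integral_ge0 => z _; rewrite expe_ge0.
have k0 : (0 < c / (8 * 2 ^+ n.+2))%R by rewrite divr_gt0// mulr_gt0// exprn_gt0.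
have L8 : 8%:E * L = +oo -> L = +oo by case: (L) L0 => [r||].
have [->|apos] := eqVneq a 0; first by rewrite expeS mul0e mule0.
have {}apos : 0 < a by rewrite lt0e apos.
have bpos : 0 < b.
  apply: (ge0_integral_gt0 mF mF2) => // z; first by rewrite expe_ge0.
  by move=> /eqP; rewrite expe_eq0 => /andP[_ /eqP].
pose g (nu : R) z := mine (F z) nu%:E.
have mg nu : measurable_fun [set: _] (g nu).
  exact: measurable_mine.
have g0 nu z : (0 < nu)%R -> 0 <= g nu z.
  by move=> nu0; rewrite /g le_min F0 lee_fin ltW.
have gD nu : (0 < nu)%R -> c%:E * (\int[leb n]_z g nu z) ^+ n.+1 <= nu%:E * D.
  move=> nu0; apply: le_trans (IH (mg nu) _ nu0) _.
    by move=> t; rewrite g0//= /g ge_min lexx orbT.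
  rewrite lee_pmul2l ?lte_fin//; apply: le_wint_weight => //.
  - by move=> z; exact: g0.
  - by move=> z; rewrite /g ge_min lexx.
  - exact: measurable_simplex_r.
have ag nu : (0 < nu)%R -> a <= \int[leb n]_z g nu z + nu^-1%:E * b.
  move=> nu0.
  rewrite -ge0_integralZl//; last 2 first.
  - by move=> z _; rewrite expe_ge0.
  - by rewrite lee_fin invr_ge0 ltW.
  rewrite -ge0_integralD//; last 3 first.
  - by move=> z _; exact: g0.
  - by move=> z _; rewrite mule_ge0 ?expe_ge0// lee_fin invr_ge0 ltW.
  - exact: emeasurable_funM.
  apply: ge0_le_integral => //.
    by apply: emeasurable_funD => //; exact: emeasurable_funM.
  move=> z _; rewrite /g; have [Fnu|Fnu] := leP (F z) nu%:E.
    by rewrite leeDl// mule_ge0 ?expe_ge0// lee_fin invr_ge0 ltW.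
  apply: (@le_trans _ _ (nu^-1%:E * F z ^+ 2)); last by rewrite leeDr// lee_fin ltW.
  rewrite expe2 muleA lee_pemull//.
  rewrite -[1](_ : nu^-1%:E * nu%:E = 1); last by rewrite -EFinM mulVf// gt_eqF.
  by rewrite lee_pmul2l ?lte_fin ?invr_gt0// ltW.
have Loo : b * D = +oo -> L = +oo.
  by move=> e; apply: L8; apply/eqP; rewrite -leye_eq -e.
have finish : L = +oo -> (c / (8 * 2 ^+ n.+2))%:E * a ^+ n.+2 <= L.
  by move=> ->; rewrite leey.
have [boo|bfin] := eqVneq b +oo.
  apply/finish/Loo; rewrite boo gt0_mulye//.
  have := gD 1%R ltr01; rewrite mul1e; apply: lt_le_trans.
  rewrite mule_gt0 ?lte_fin// expe_gt0//.
  apply: (ge0_integral_gt0 mF (mg 1%R)) => // [z|z].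
    by exact: g0.
  rewrite /g; have [//|_ /eqP] := leP (F z) 1%:E.
  by rewrite eqe oner_eq0.
have {bfin} : b \is a fin_num by rewrite ge0_fin_numE// ltey.
case: b b0 bpos ag bDL Loo => [b|//|//] b0; rewrite lte_fin => bpos ag bDL Loo _.
have [aoo|afin] := eqVneq a +oo.
  have goo : \int[leb n]_z g 1%R z = +oo.
    have := ag 1%R ltr01; rewrite aoo leye_eq invr1 mul1e.
    by case: (\int[leb n]_z g 1%R z).
  apply/finish/Loo; have := gD 1%R ltr01.
  rewrite goo expey mul1e gt0_muley ?lte_fin// leye_eq => /eqP ->.
  by rewrite gt0_muley ?lte_fin.
have {afin} : a \is a fin_num by rewrite ge0_fin_numE// ltey.
case: a a0 apos ag finish => [a|//|//] a0; rewrite lte_fin => apos ag finish _.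
have nu0 : (0 < 2 * b / a)%R by rewrite divr_gt0// mulr_gt0.
have ga : (a / 2)%:E <= \int[leb n]_z g (2 * b / a)%R z.
  have := ag _ nu0; rewrite -EFinM invf_div (_ : (a / (2 * b) * b = a / 2)%R); last first.
    by field; rewrite !gt_eqF.
  case: (\int[leb n]_z _) => [r| |]; rewrite ?leey// -EFinD !lee_fin; lra.
have := gD _ nu0; set P := \int[leb n]_z _ in ga *.
have /le_trans/[apply] : c%:E * (a / 2)%:E ^+ n.+1 <= c%:E * P ^+ n.+1.
  by rewrite lee_pmul2l ?lte_fin//; apply: le_expe => //; rewrite lee_fin divr_ge0.
case: D D0 bDL {gD} Loo => [d||] // d0; last first.
  by move=> _ Loo _; apply/finish/Loo; rewrite gt0_muley.
case: L L0 {L8} finish => [l||] // l0; last by move=> finish _ _ _; exact: finish.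
move=> _; rewrite -!EFin_expe -!EFinM !lee_fin => bdl _ cd.
have : (c * (a / 2) ^+ n.+1 * (a / 2) <= 2 * b / a * d * (a / 2))%R.
  by rewrite ler_pM2r// divr_gt0.
rewrite (_ : (2 * b / a * d * (a / 2) = b * d)%R); last by field; rewrite gt_eqF.
rewrite (_ : (c / (8 * 2 ^+ n.+2) * a ^+ n.+2 = (c * (a / 2) ^+ n.+1 * (a / 2)) / 8)%R).
  by move=> h; lra.
by rewrite !exprS expr_div_n; field; rewrite expf_neq0.
Qed.

End step.

(** The bound lam is a parameter because the induction truncates the slice
    integrals at a level that depends on f. Both sides scale alike under
    (f, lam) |-> (r f, r lam) and under dilations of R^n. *)
Lemma simplex_lower_bound n : exists2 c : R, (0 < c)%R &
  forall (x : euclid R n) (f : euclid R n -> \bar R) (lam : R),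
    measurable_fun [set: _] f -> (forall t, 0 <= f t <= lam%:E) -> (0 < lam)%R ->
    c%:E * (\int[leb n]_z f z) ^+ n.+1 <=
    lam%:E * wint (leb n) f (fun ts => `|\det (simplex_mx ts x)|%:E).
Proof.
elim: n => [|n [c c0 IH]].
  exists 1%R => // x f lam mf flam lam0.
  rewrite integral_leb0 /= det_mx00 normr1 mul1e mule1.
  by have /andP[] := flam [tuple].
exists (c / (8 * 2 ^+ n.+2))%R.
  by rewrite divr_gt0// mulr_gt0// exprn_gt0.
move=> x f lam mf flam lam0; apply: simplex_step => // g nu.
exact: IH.
Qed.

End lower.

(** * The paraboloid *)

Section paraboloid_bound.
Context {R : realType}.
Local Notation mu := (@lebesgue_measure R).
Local Notation TR := (measurableTypeR R).
Local Open Scope ereal_scope.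
Variables (m : nat) (E : set (euclid R m.+1 * TR)) (x' : R).
Hypothesis mE : measurable E.

Let d := m.+1.

(* The indicator of the set A_x of those y with (y, x' + |y - x|^2) in E. *)
Let f (x y : euclid R d) : \bar R := (\1_E (y, (x' + sqdist y x)%R : TR))%:E.

Let f0 x y : 0 <= f x y. Proof. by rewrite lee_fin. Qed.

Let mf : measurable_fun [set: euclid R d * euclid R d] (fun p => f p.1 p.2).
Proof.
apply/measurable_EFinP.
apply: (measurableT_comp (f := (\1_E : _ -> R)) (g := fun p : euclid R d * euclid R d =>
   (p.2, (x' + sqdist p.2 p.1)%R : TR))) => //.
apply: measurable_fun_pair => //; apply: measurable_funD => //.
apply: measurable_sqn => i; under eq_fun do rewrite mxE [X in (_ + X)%R]mxE.
apply: measurable_funB.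
  exact: (measurableT_comp (@measurable_vec _ _ i)).
exact: (measurableT_comp (@measurable_vec _ _ i)).
Qed.

Lemma paraT_centred x : paraT \1_E x x' = \int[leb d]_y f x y.
Proof.
have mfx : measurable_fun [set: euclid R d] (f x).
  exact: (measurableT_comp mf (measurable_pair1 x)).
rewrite -(integral_translate (vec x) mfx (f0 x)).
apply: eq_integral => t _; rewrite /f /affine mul1mx.
congr (\1_E (_, _))%:E.
  by apply/eq_from_tnth => i; rewrite !tnth_mktuple !mxE addrC.
rewrite /sqdist tupK addrK sqnE /enorm sqr_sqrtr.
  by congr (_ + _)%R; apply: eq_bigr => i _; rewrite mxE.
by rewrite sumr_ge0// => i _; exact: sqr_ge0.
Qed.

Lemma integral_wint_paraboloid_le :
  \int[leb d]_x wint (leb d) (f x) (fun ts => `|\det (simplex_mx ts x)|%:E)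
  <= ((leb d \x mu) E) ^+ d.
Proof.
pose g y := \int[mu]_u (\1_E (y, u))%:E.
have mEf : measurable_fun [set: euclid R d * TR] (fun p => (\1_E p)%:E : \bar R).
  exact/measurable_EFinP.
have mE2 : measurable_fun [set: euclid R d * TR] (fun p => (\1_E (p.1, p.2))%:E : \bar R).
  by rewrite (_ : (fun _ => _) = (fun p => (\1_E p)%:E : \bar R))//; apply/funext => -[].
rewrite (_ : (leb d \x mu) E = \int[leb d]_y g y); last first.
  rewrite -[X in _ X = _]setIT -(integral_indic (leb d \x mu))//.
  by rewrite fubini_tonelli1.
rewrite -[leRHS]mul1e.
apply: (@integral_wint_le _ _ _ (leb d) _ _ (leb d) f g) => //.
- exact: (measurable_intr _ mE2).
- by move=> y; exact: integral_ge0.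
- exact: measurable_simplex.
move=> ts; rewrite mul1e.
apply: le_trans
  (@integral_spheres_le R m ts (fun i u => (\1_E (tnth ts i, u))%:E) x' _ _) => //.
  by under eq_integral do rewrite muleC.
move=> i; exact: (measurableT_comp mEf (measurable_pair1 (tnth ts i))).
Qed.

(** The constant c is a parameter because it has to be chosen before E and
    x'. *)
Lemma paraT_norm_le (c : R) : (0 < c)%R ->
  (forall (x : euclid R d) (f : euclid R d -> \bar R) (lam : R),
    measurable_fun [set: _] f -> (forall t, 0 <= f t <= lam%:E) -> (0 < lam)%R ->
    c%:E * (\int[leb d]_z f z) ^+ d.+1 <=
    lam%:E * wint (leb d) f (fun ts => `|\det (simplex_mx ts x)|%:E)) ->
  \int[leb d]_x (`|paraT \1_E x x'| ^+ d.+1)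
    <= c^-1%:E * ((leb d \x mu) E) ^+ d.
Proof.
move=> c0 hc.
have mF := measurable_intr (leb d) mf f0.
have mFn : measurable_fun [set: _] (fun x => (\int[leb d]_y f x y) ^+ d.+1).
  elim: d.+1 => [|k IH]; first by under eq_fun do rewrite expe0; exact: measurable_cst.
  by under eq_fun do rewrite expeS; exact: emeasurable_funM.
under eq_integral do rewrite paraT_centred gee0_abs ?integral_ge0//.
rewrite -[leLHS]mul1e -[1](_ : c^-1%:E * c%:E = 1); last first.
  by rewrite -EFinM mulVf// gt_eqF.
rewrite -muleA lee_pmul2l ?lte_fin ?invr_gt0//.
apply: le_trans integral_wint_paraboloid_le.
rewrite -ge0_integralZl//; last 2 first.
- by move=> x _; rewrite expe_ge0// integral_ge0.
- by rewrite lee_fin ltW.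
apply: ge0_le_integral => //.
- move=> x _; apply: mule_ge0; first by rewrite lee_fin ltW.
  by rewrite expe_ge0// integral_ge0.
- exact: emeasurable_funM.
- apply: measurable_wint => //; exact: measurable_simplex.
move=> x _; rewrite -[leRHS]mul1e; apply: hc => //.
  exact: (measurableT_comp mf (measurable_pair1 x)).
by move=> t; rewrite f0 /f lee_fin indicE lern1 leq_b1.
Qed.
End paraboloid_bound.

Lemma poweR_natX {R : realType} (X : \bar R) n :
  (0 <= X)%E -> (X ^+ n.+1 = X `^ (n.+1)%:R)%E.
Proof.
case: X => [r r0|_|//].
  by rewrite poweR_EFin powR_mulrn// EFin_expe.
by rewrite expey poweRyr// pnatr_eq0.
Qed.

Theorem theorem5 (R : realType) (ell : nat) (hell : (2 <= ell)%N) :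
  exists C : R, forall E : set (euclid R ell.-1 * measurableTypeR R),
    measurable E ->
    (ess_sup (@lebesgue_measure R)
       (fun x' => (\int[leb ell.-1]_x (`|paraT \1_E x x'| ^+ ell))
                    `^ (ell%:R^-1)%R)
     <= C%:E * (leb ell.-1 \x lebesgue_measure) E
                 `^ (ell.-1%:R / ell%:R)%R)%E.
Proof.
case: ell hell => [|[|m]]// _; have [c c0 hc] := @simplex_lower_bound R m.+1.
exists (c^-1 `^ (m.+2%:R)^-1) => E mE.
apply/ess_supP/aeW => x'.
have X0 : (0 <= (leb m.+1 \x @lebesgue_measure R) E)%E by exact: measure_ge0.
rewrite poweRrM -poweR_natX// -poweR_EFin -poweRM ?expe_ge0//; last first.
  by rewrite lee_fin invr_ge0 ltW.
have ci0 : (0 <= c^-1%:E)%E by rewrite lee_fin invr_ge0 ltW.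
apply: gt0_ler_poweR.
- by rewrite invr_ge0.
- rewrite in_itv; apply/andP; split; last exact: leey.
  by apply: integral_ge0 => x _; exact: expe_ge0.
- rewrite in_itv; apply/andP; split; last exact: leey.
  by apply: mule_ge0 => //; exact: expe_ge0.
- exact: paraT_norm_le.
Qed.
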